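(* Let $k$ be a field, let $H$ be a finite-dimensional Hopf algebra over $k$ with bijective antipode, and let $T$ be a left $H$-torsor. Let $A$ be a noetherian connected graded right $H$-comodule algebra of finite global dimension. If $A$ has property $\chi$, then so does $\widetilde A$.
   Context: A right (left) $H$-comodule algebra is an algebra object in the monoidal category of right (left) $H$-comodules. A left $H$-torsor is a left $H$-comodule algebra $T$, with structure map $\rho:T\to H\otimes T$ and multiplication $m$, such that (1) $T\cong H$ as left $H$-comodules; (2) the ring of coinvariants $\{t\in T: \rho(t)=1\otimes t\}$ equals $k$; (3) the map $(\mathrm{id}\otimes m)\circ(\rho\otimes \mathrm{id}):T\otimes T\to H\otimes T$ is bijective. A connected graded $H$-comodule algebra is an $\mathbb{N}$-graded algebra $A$ with $A_0=k$ that is a right $H$-comodule algebra such that every $A_i$ is a subcomodule. With $\rho_A:A\to A\otimes H$ its structure map, $\widetilde A=\{x\in A\otimes T:(\rho_A\otimes\mathrm{id})(x)=(\mathrm{id}\otimes\rho)(x)\}$, a graded subalgebra of $A\otimes T$ ($T$ in degree $0$). Property $\chi$: an $\mathbb N$-graded algebra $A$ has property $\chi$ if for all non-negative integers $i,d$ and all finitely generated graded left $A$-modules $N$ there is an integer $n_0$ such that $\underline{\mathrm{Ext}}^i_A(A/A_{\ge n},N)_{\ge d}$ is a finitely generated left $A$-module for all $n\ge n_0$. Here $\underline{\mathrm{Ext}}^i$ are the derived functors of $\underline{\mathrm{Hom}}(M,N)=\bigoplus_{d\in\mathbb Z}\mathrm{Hom}(M,N(d))$ on graded left modules, and the left $A$-module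 structure comes from the right $A$-action on $A/A_{\ge n}$. *)

(* Defs.v *)
From HB Require Import structures.
From mathcomp Require Import all_boot order ssralg ssrnum ssrint.
From mathcomp Require Import generic_quotient ring_quotient sesquilinear falgebra.
From mathcomp Require Import boolp classical_sets.

Set Implicit Arguments.
Unset Strict Implicit.
Unset Printing Implicit Defensive.
Import GRing.Theory.
Local Open Scope ring_scope.
Local Open Scope quotient_scope.

Local Notation bilin f := (bilinear_for *:%R *:%R f).

Section LinearFunctional.
Variables (k : fieldType) (V : lmodType k).

Let subsp (W : set V) := forall c x y, W x -> W y -> W (c *: x + y).

Lemma exists_functional (v : V) : v != 0 ->
  exists f : V -> k^o, linear f /\ f v = 1.
Proof.
move=> v0.
pose P (W : set V) := subsp W /\ ~ W v.
have [W [[Wl Wv] Wmax]] : exists A, P A /\ forall B, (A `<` B)%classic -> ~ P B.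
  apply: Zorn_bigcup => F FP Ftot; split; last first.
    by move=> [X FX Xv]; have [] := FP _ FX.
  move=> c x y [X FX Xx] [Y FY Yy].
  have [XY|YX] := Ftot _ _ FX FY.
    by exists Y => //; apply: (FP _ FY).1 => //; exact: XY.
  by exists X => //; apply: (FP _ FX).1 => //; exact: YX.
have W0 : W 0.
  apply: contrapT => nW0.
  have Wempty x : ~ W x by move=> Wx; apply: nW0; have := Wl (-1) _ _ Wx Wx;
    rewrite scaleN1r addNr.
  apply: (Wmax (fun y => y = 0)); first by split => [x /Wempty//|/(_ 0 erefl)].
  split; first by move=> c x y /= -> ->; rewrite scaler0 addr0.
  by move=> /= v00; rewrite v00 eqxx in v0.
have WZ c x : W x -> W (c *: x).
  by move=> Wx; have := Wl c _ _ Wx W0; rewrite addr0.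
have WD x y : W x -> W y -> W (x + y).
  by move=> Wx Wy; have := Wl 1 _ _ Wx Wy; rewrite scale1r.
have dec x : exists c, W (x - c *: v).
  have [Wx|nWx] := pselect (W x); first by exists 0; rewrite scale0r subr0.
  apply: contrapT => nc.
  apply: (Wmax (fun y => exists2 w, W w & exists c, y = w + c *: x)).
    split; first by move=> y Wy; exists y => //; exists 0; rewrite scale0r addr0.
    by move=> /(_ x) h; apply: nWx; apply: h; exists 0 => //; exists 1;
      rewrite scale1r add0r.
  split.
    move=> c _ _ [w Ww [a ->]] [w' Ww' [a' ->]].
    exists (c *: w + w'); first exact: Wl.
    exists (c * a + a').
    by rewrite scalerDr scalerA scalerDl addrACA.
  move=> [w Ww [c vE]]; have [c0|c0] := eqVneq c 0.
    by apply: Wv; rewrite vE c0 scale0r addr0.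
  apply: nc; exists c^-1; rewrite vE scalerDr scalerA mulVf // scale1r.
  by rewrite opprD addrCA subrr addr0 -scaleN1r; exact/WZ/WZ.
have uni x c d : W (x - c *: v) -> W (x - d *: v) -> c = d.
  move=> Wc Wd; apply/eqP; rewrite -subr_eq0; apply/eqP.
  have [//|cd0] := eqVneq (c - d) 0; case: Wv.
  have -> : v = (c - d)^-1 *: ((-1) *: (x - c *: v) + (x - d *: v)).
    rewrite scaleN1r opprB addrA subrK -scalerBl scalerA mulVf //.
    by rewrite scale1r.
  by apply: WZ; exact: Wl.
pose f x : k^o := projT1 (cid (dec x)).
have fP x : W (x - f x *: v) by rewrite /f; case: cid.
exists f; split.
  move=> a x y; apply: (uni (a *: x + y)); first exact: fP.
  have := Wl a _ _ (fP x) (fP y).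
  by rewrite scalerBr scalerA addrACA -opprD scalerDl.
apply: (uni v); first exact: fP.
by rewrite scale1r subrr.
Qed.
End LinearFunctional.

Section Tensor.
Variables (k : fieldType) (U V : lmodType k).

(* Lists of pairs are formal sums; [tens_rel] is the congruence generated by the
   bilinearity relations. *)
Inductive tens_rel : seq (U * V) -> seq (U * V) -> Prop :=
| tr_refl s : tens_rel s s
| tr_sym s t : tens_rel s t -> tens_rel t s
| tr_trans s t r : tens_rel s t -> tens_rel t r -> tens_rel s r
| tr_cat s s' t t' :
    tens_rel s s' -> tens_rel t t' -> tens_rel (s ++ t) (s' ++ t')
| tr_comm s t : tens_rel (s ++ t) (t ++ s)
| tr_addl u u' v : tens_rel [:: (u + u', v)] [:: (u, v); (u', v)]
| tr_addr u v v' : tens_rel [:: (u, v + v')] [:: (u, v); (u, v')]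
| tr_scale c u v : tens_rel [:: (c *: u, v)] [:: (u, c *: v)]
| tr_zero v : tens_rel [:: (0, v)] [::].

Definition tens_relb (s t : seq (U * V)) : bool := `[< tens_rel s t >].

Lemma tens_relb_refl : reflexive tens_relb.
Proof. by move=> s; apply/asboolP; exact: tr_refl. Qed.
Lemma tens_relb_sym : symmetric tens_relb.
Proof. by move=> s t; apply/asboolP/asboolP; exact: tr_sym. Qed.
Lemma tens_relb_trans : transitive tens_relb.
Proof.
by move=> s t r /asboolP h1 /asboolP h2; apply/asboolP; exact: tr_trans h2.
Qed.

Canonical tens_equiv_rel := EquivRel tens_relb
  tens_relb_refl tens_relb_sym tens_relb_trans.
Canonical tens_encModRel := defaultEncModRel tens_relb.

Definition tens : Type := {eq_quot tens_relb}.
HB.instance Definition _ : EqQuotient _ tens_relb tens := EqQuotient.on tens.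
HB.instance Definition _ := Choice.on tens.

Definition tpure (u : U) (v : V) : tens := \pi_tens [:: (u, v)].

Lemma tens_piP s t : tens_rel s t -> \pi_tens s = \pi_tens t.
Proof. by move=> h; apply/eqquotP; apply/asboolP. Qed.
Lemma tens_reprP s : tens_rel (repr (\pi_tens s)) s.
Proof. by have /eqquotP/asboolP := reprK (\pi_tens s). Qed.

Lemma tens_case (P : tens -> Prop) : (forall s, P (\pi_tens s)) -> forall x, P x.
Proof. by move=> h x; rewrite -[x]reprK. Qed.

Definition tens_add (x y : tens) : tens := \pi_tens (repr x ++ repr y).
Definition tens_zero : tens := \pi_tens [::].
Definition tens_scale (c : k) (x : tens) : tens :=
  \pi_tens [seq (c *: p.1, p.2) | p <- repr x].

Fact tens_addE s t : tens_add (\pi_tens s) (\pi_tens t) = \pi_tens (s ++ t).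
Proof. by apply: tens_piP; apply: tr_cat; exact: tens_reprP. Qed.

Fact tens_rel_scale c s t : tens_rel s t ->
  tens_rel [seq (c *: p.1, p.2) | p <- s] [seq (c *: p.1, p.2) | p <- t].
Proof.
elim=> {s t}.
- by move=> s; exact: tr_refl.
- by move=> s t _; exact: tr_sym.
- by move=> s t r _ h _; exact: tr_trans h.
- by move=> s s' t t' _ h1 _ h2; rewrite !map_cat; exact: tr_cat.
- by move=> s t; rewrite !map_cat; exact: tr_comm.
- by move=> u u' v /=; rewrite scalerDr; exact: tr_addl.
- by move=> u v v' /=; exact: tr_addr.
- by move=> d u v /=; rewrite scalerA mulrC -scalerA; exact: tr_scale.
- by move=> v /=; rewrite scaler0; exact: tr_zero.
Qed.

Fact tens_scaleE c s : tens_scale c (\pi_tens s) = \pi_tens [seq (c *: p.1, p.2) | p <- s].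
Proof. by apply: tens_piP; apply: tens_rel_scale; exact: tens_reprP. Qed.

Fact tens_addA : associative tens_add.
Proof. by do 3!elim/tens_case=> ?; rewrite !tens_addE catA. Qed.
Fact tens_addC : commutative tens_add.
Proof. by do 2!elim/tens_case=> ?; rewrite !tens_addE; exact/tens_piP/tr_comm. Qed.
Fact tens_add0 : left_id tens_zero tens_add.
Proof. by elim/tens_case=> s; rewrite tens_addE. Qed.
Fact tens_cons p s : \pi_tens (p :: s) = tens_add (\pi_tens [:: p]) (\pi_tens s).
Proof. by rewrite tens_addE. Qed.
Fact tens_addACA : interchange tens_add tens_add.
Proof. by move=> a b c d; rewrite -!tens_addA (tens_addA b) (tens_addC b) -tens_addA. Qed.
Fact tens_pureD u u' v : tpure (u + u') v = tens_add (tpure u v) (tpure u' v).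
Proof. by rewrite tens_addE; exact/tens_piP/tr_addl. Qed.
Fact tens_pure0 v : tpure 0 v = tens_zero.
Proof. exact/tens_piP/tr_zero. Qed.
Fact tens_addN : left_inverse tens_zero (tens_scale (-1)) tens_add.
Proof.
elim/tens_case; elim=> [|[u v] s ih]; first by rewrite tens_scaleE tens_add0.
rewrite tens_scaleE in ih.
rewrite tens_scaleE /= tens_cons (tens_cons (u, v)) tens_addACA ih.
by rewrite -[RHS](tens_pure0 v) -[in RHS](addNr u) tens_pureD scaleN1r tens_addC tens_add0.
Qed.

HB.instance Definition _ := GRing.isZmodule.Build tens tens_addA tens_addC tens_add0 tens_addN.

Let plusE (x y : tens) : x + y = tens_add x y. Proof. by []. Qed.

Lemma tens_pi_cat s t : \pi_tens (s ++ t) = \pi_tens s + \pi_tens t.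
Proof. exact/esym/tens_addE. Qed.

Fact tens_scaleA a b x : tens_scale a (tens_scale b x) = tens_scale (a * b) x.
Proof.
elim/tens_case: x => s; rewrite !tens_scaleE -map_comp.
by congr (\pi_tens _); apply: eq_map => -[u v] /=; rewrite scalerA.
Qed.
Fact tens_scale1 : left_id 1 tens_scale.
Proof.
elim/tens_case=> s; rewrite tens_scaleE; congr (\pi_tens _); rewrite -[RHS]map_id.
by apply: eq_map => -[u v] /=; rewrite scale1r.
Qed.
Fact tens_scaleDr : right_distributive tens_scale +%R.
Proof.
move=> a; do 2!elim/tens_case=> ?.
by rewrite -tens_pi_cat !tens_scaleE map_cat tens_pi_cat.
Qed.
Fact tens_scaleDl x : {morph tens_scale^~ x : a b / a + b}.
Proof.
elim/tens_case: x => s a b; rewrite !tens_scaleE.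
elim: s => [|[u v] s ih] /=; first by rewrite -tens_pi_cat.
rewrite tens_cons ih (tens_cons (a *: u, v)) (tens_cons (b *: u, v)).
by rewrite !plusE -tens_addACA scalerDl -tens_pureD.
Qed.

HB.instance Definition _ := GRing.Zmodule_isLmodule.Build k tens
  tens_scaleA tens_scale1 tens_scaleDr tens_scaleDl.

Lemma tpure_bilin : bilin tpure.
Proof.
have Z c u v : tpure (c *: u) v = c *: tpure u v by apply/esym; exact: tens_scaleE.
split=> [v c u u' | u c v v'] /=; first by rewrite -Z; exact: tens_pureD.
rewrite -Z [LHS](_ : _ = tpure u (c *: v) + tpure u v').
  by congr (_ + _); apply/esym/tens_piP/tr_scale.
by rewrite -tens_pi_cat; apply/tens_piP/tr_addr.
Qed.
HB.instance Definition _ :=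
  bilinear_isBilinear.Build k U V tens *:%R *:%R tpure tpure_bilin.

Lemma tens_piE s : \pi_tens s = \sum_(p <- s) tpure p.1 p.2.
Proof.
elim: s => [|[u v] s ih]; first by rewrite big_nil.
by rewrite big_cons -ih; exact: tens_cons.
Qed.

Lemma tens_sumE (x : tens) : x = \sum_(p <- repr x) tpure p.1 p.2.
Proof. by rewrite -tens_piE reprK. Qed.

Lemma tens_ind (P : tens -> Prop) :
  P 0 -> (forall u v x, P x -> P (tpure u v + x)) -> forall x, P x.
Proof.
move=> P0 PD x; rewrite (tens_sumE x).
elim: (repr x) => [|p s ih]; first by rewrite big_nil.
by rewrite big_cons; apply: PD.
Qed.

End Tensor.

Notation "u *t v" := (tpure u v) (at level 40, left associativity) : ring_scope.
Notation "U ⊗ V" := (tens U V) (at level 40, left associativity) : type_scope.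

Section Lift.
Variables (k : fieldType) (U V W : lmodType k).

Definition tens_lift (f : U -> V -> W) (x : U ⊗ V) : W :=
  \sum_(p <- repr x) f p.1 p.2.

Variable f : {bilinear U -> V -> W}.

Let lift_rel s t : tens_rel s t ->
  \sum_(p <- s) f p.1 p.2 = \sum_(p <- t) f p.1 p.2.
Proof.
elim=> {s t} //.
- by move=> s t r _ -> _ ->.
- by move=> s s' t t' _ h1 _ h2; rewrite !big_cat /= h1 h2.
- by move=> s t; rewrite !big_cat /= addrC.
- by move=> u u' v; rewrite !big_cons !big_nil !addr0 linearDl.
- by move=> u v v'; rewrite !big_cons !big_nil !addr0 linearD.
- by move=> c u v; rewrite !big_cons !big_nil !addr0 linearZl_LR linearZ.
- by move=> v; rewrite big_cons !big_nil !addr0 linear0l.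
Qed.

Let lift_pi s : tens_lift f (\pi_(tens U V) s) = \sum_(p <- s) f p.1 p.2.
Proof. by apply: lift_rel; exact: tens_reprP. Qed.

Lemma tens_lift_pure u v : tens_lift f (u *t v) = f u v.
Proof. by rewrite lift_pi big_cons big_nil addr0. Qed.

Lemma tens_lift_linear : linear (tens_lift f).
Proof.
have D x y : tens_lift f (x + y) = tens_lift f x + tens_lift f y.
  elim/tens_case: x => s; elim/tens_case: y => t.
  by rewrite -tens_pi_cat !lift_pi big_cat /=.
move=> c x y; rewrite D; congr (_ + _).
have lift0 : tens_lift f 0 = 0 by rewrite (_ : 0 = \pi_(tens U V) [::]) // lift_pi big_nil.
elim/tens_ind: x => [|u v x ih]; first by rewrite scaler0 lift0 scaler0.
rewrite scalerDr !D ih -linearZl_LR !tens_lift_pure scalerDr.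
by rewrite linearZl_LR.
Qed.

HB.instance Definition _ :=
  GRing.isLinear.Build k (U ⊗ V) W *:%R (tens_lift f) tens_lift_linear.

End Lift.

Section TensMap.
Variables (k : fieldType) (U V U' V' : lmodType k).
Variables (f : {linear U -> U'}) (g : {linear V -> V'}).

Definition tens_map_pure (u : U) (v : V) : U' ⊗ V' := f u *t g v.
Fact tens_map_bilin : bilin tens_map_pure.
Proof.
split=> [v c u u' | u c v v']; rewrite /tens_map_pure linearP.
  by rewrite linearPl.
by rewrite linearPr.
Qed.
HB.instance Definition _ :=
  bilinear_isBilinear.Build k U V (U' ⊗ V') *:%R *:%R tens_map_pure tens_map_bilin.

Definition tens_map : U ⊗ V -> U' ⊗ V' := tens_lift tens_map_pure.
HB.instance Definition _ := GRing.Linear.on tens_map.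

Lemma tens_mapE u v : tens_map (u *t v) = f u *t g v.
Proof. exact: tens_lift_pure. Qed.
End TensMap.

Section TensAssoc.
Variables (k : fieldType) (U V W : lmodType k).

Definition tens_assoc_in (w : W) (u : U) (v : V) : U ⊗ (V ⊗ W) := u *t (v *t w).
Fact tens_assoc_in_bilin w : bilin (tens_assoc_in w).
Proof.
split=> [v c u u' | u c v v']; rewrite /tens_assoc_in.
  by rewrite linearPl.
by rewrite linearPl linearPr.
Qed.
HB.instance Definition _ w := bilinear_isBilinear.Build k U V (U ⊗ (V ⊗ W))
  *:%R *:%R (tens_assoc_in w) (tens_assoc_in_bilin w).

Definition tens_assoc_out (x : U ⊗ V) (w : W) : U ⊗ (V ⊗ W) :=
  tens_lift (tens_assoc_in w) x.
Fact tens_assoc_out_bilin : bilin tens_assoc_out.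
Proof.
split=> [w c x y | x c w w']; first exact: linearP.
rewrite /tens_assoc_out.
elim/tens_ind: x => [|u v x ih]; first by rewrite !linear0 /= ?scaler0 addr0.
rewrite !linearD /= ih !tens_lift_pure /= /tens_assoc_in !linearPr.
by rewrite scalerDr addrACA.
Qed.
HB.instance Definition _ := bilinear_isBilinear.Build k (U ⊗ V) W (U ⊗ (V ⊗ W))
  *:%R *:%R tens_assoc_out tens_assoc_out_bilin.

Definition tens_assoc : (U ⊗ V) ⊗ W -> U ⊗ (V ⊗ W) := tens_lift tens_assoc_out.
HB.instance Definition _ := GRing.Linear.on tens_assoc.

Lemma tens_assocE u v w : tens_assoc (u *t v *t w) = u *t (v *t w).
Proof. by rewrite [LHS]tens_lift_pure [LHS]tens_lift_pure. Qed.
End TensAssoc.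

Section TensAlgebra.
Variables (k : fieldType) (A B : algType k).

Definition tens_mul_in (a : A) (b : B) (a' : A) (b' : B) : A ⊗ B :=
  (a * a') *t (b * b').
Fact tens_mul_in_bilin a b : bilin (tens_mul_in a b).
Proof.
split=> [v c u u' | u c v v']; rewrite /tens_mul_in mulrDr -scalerAr.
  by rewrite linearPl.
by rewrite linearPr.
Qed.
HB.instance Definition _ a b := bilinear_isBilinear.Build k A B (A ⊗ B)
  *:%R *:%R (tens_mul_in a b) (tens_mul_in_bilin a b).

Definition tens_mul_out (y : A ⊗ B) (a : A) (b : B) : A ⊗ B :=
  tens_lift (tens_mul_in a b) y.
Fact tens_mul_out_bilin y : bilin (tens_mul_out y).
Proof.
split=> [v c u u' | u c v v']; rewrite /tens_mul_out.
  elim/tens_ind: y => [|a b y ih]; first by rewrite !linear0 /= ?scaler0 addr0.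
  rewrite !linearD /= ih !tens_lift_pure /= /tens_mul_in mulrDl -scalerAl.
  by rewrite linearPl scalerDr addrACA.
elim/tens_ind: y => [|a b y ih]; first by rewrite !linear0 /= ?scaler0 addr0.
rewrite !linearD /= ih !tens_lift_pure /= /tens_mul_in mulrDl -scalerAl.
by rewrite linearPr scalerDr addrACA.
Qed.
HB.instance Definition _ y := bilinear_isBilinear.Build k A B (A ⊗ B)
  *:%R *:%R (tens_mul_out y) (tens_mul_out_bilin y).

Definition tens_mul (x y : A ⊗ B) : A ⊗ B := tens_lift (tens_mul_out y) x.
Definition tens_one : A ⊗ B := 1 *t 1.

Fact tens_mulE a b a' b' :
  tens_mul (a *t b) (a' *t b') = (a * a') *t (b * b').
Proof. by rewrite [LHS]tens_lift_pure [LHS]tens_lift_pure. Qed.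
Fact tens_mul_linl y : linear (tens_mul^~ y).
Proof. exact: linearP. Qed.
Fact tens_mul_linr x : linear (tens_mul x).
Proof.
move=> c y z; rewrite /tens_mul.
elim/tens_ind: x => [|a b x ih]; first by rewrite !linear0 /= ?scaler0 addr0.
rewrite !linearD /= ih !tens_lift_pure /= /tens_mul_out linearP.
by rewrite addrACA.
Qed.
Fact tens_mulDl : left_distributive tens_mul +%R.
Proof. by move=> x y z; have := tens_mul_linl z 1 x y; rewrite !scale1r. Qed.
Fact tens_mulDr : right_distributive tens_mul +%R.
Proof. by move=> x y z; have := tens_mul_linr x 1 y z; rewrite !scale1r. Qed.
Fact tens_mul0x y : tens_mul 0 y = 0.
Proof. exact: linear0. Qed.
Fact tens_mulx0 x : tens_mul x 0 = 0.
Proof. by apply: (addrI (tens_mul x 0)); rewrite -tens_mulDr !addr0. Qed.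
Fact tens_mulA : associative tens_mul.
Proof.
move=> x y z.
elim/tens_ind: x => [|a b x ih]; first by rewrite !tens_mul0x.
rewrite !tens_mulDl ih; congr (_ + _) => {x ih}.
elim/tens_ind: y => [|a' b' y ih]; first by rewrite tens_mulx0 !tens_mul0x tens_mulx0.
rewrite !(tens_mulDl, tens_mulDr) ih; congr (_ + _) => {y ih}.
elim/tens_ind: z => [|a'' b'' z ih]; first by rewrite !tens_mulx0.
by rewrite !tens_mulDr ih !tens_mulE !mulrA.
Qed.
Fact tens_mul1 : left_id tens_one tens_mul.
Proof.
elim/tens_ind=> [|a b x ih]; first exact: tens_mulx0.
by rewrite tens_mulDr ih tens_mulE !mul1r.
Qed.
Fact tens_mulr1 : right_id tens_one tens_mul.
Proof.
elim/tens_ind=> [|a b x ih]; first exact: tens_mul0x.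
by rewrite tens_mulDl ih tens_mulE !mulr1.
Qed.
Fact tens_one_neq0 : tens_one != 0.
Proof.
have [f [flin f1]] := exists_functional (oner_neq0 B).
pose g (a : A) (b : B) : A := (f b : k) *: a.
have gb : bilin g.
  split=> [b c a a' | a c b b']; rewrite /g /=.
    by rewrite scalerDr !scalerA mulrC.
  by rewrite flin [X in X *: a = _]/(_ + _ : k) scalerDl scalerA.
pose g' : {bilinear A -> B -> A} :=
  HB.pack_for {bilinear A -> B -> A} g
    (bilinear_isBilinear.Build k A B A *:%R *:%R g gb).
apply/eqP => one0; have := tens_lift_pure g' 1 1.
rewrite -[1 *t 1]/tens_one one0 linear0 /= /g f1 scale1r => /esym/eqP.
by rewrite oner_eq0.
Qed.

HB.instance Definition _ := GRing.Zmodule_isNzRing.Build (A ⊗ B)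
  tens_mulA tens_mul1 tens_mulr1 tens_mulDl tens_mulDr tens_one_neq0.

Fact tens_scaleAl (c : k) (x y : A ⊗ B) : c *: (x * y) = (c *: x) * y.
Proof. by have := tens_mul_linl y c x 0; rewrite addr0 tens_mul0x addr0. Qed.
Fact tens_scaleAr (c : k) (x y : A ⊗ B) : c *: (x * y) = x * (c *: y).
Proof. by have := tens_mul_linr x c y 0; rewrite addr0 tens_mulx0 addr0. Qed.
HB.instance Definition _ :=
  GRing.Lmodule_isLalgebra.Build k (A ⊗ B) tens_scaleAl.
HB.instance Definition _ :=
  GRing.Lalgebra_isAlgebra.Build k (A ⊗ B) tens_scaleAr.

Lemma tpureM (a a' : A) (b b' : B) :
  (a *t b) * (a' *t b') = (a * a') *t (b * b').
Proof. exact: tens_mulE. Qed.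
Lemma tpure1 : (1 : A) *t (1 : B) = 1 :> A ⊗ B.
Proof. by []. Qed.
End TensAlgebra.

Section TensMapMorphism.
Variables (k : fieldType) (A B A' B' : algType k).
Variables (f : {lrmorphism A -> A'}) (g : {lrmorphism B -> B'}).

Fact tens_map_monoid : monoid_morphism (tens_map f g).
Proof.
split; first by rewrite -[1]tpure1 tens_mapE !rmorph1.
move=> x y; elim/tens_ind: x => [|a b x ih]; first by rewrite mul0r linear0 mul0r.
rewrite mulrDl !linearD /= ih mulrDl; congr (_ + _) => {x ih}.
elim/tens_ind: y => [|a' b' y ih]; first by rewrite mulr0 linear0 mulr0.
by rewrite mulrDr !linearD /= ih mulrDr tpureM !tens_mapE !rmorphM tpureM.
Qed.
HB.instance Definition _ :=
  GRing.isMonoidMorphism.Build (A ⊗ B) (A' ⊗ B') (tens_map f g) tens_map_monoid.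
End TensMapMorphism.

Section TensAssocMorphism.
Variables (k : fieldType) (A B C : algType k).

Fact tens_assoc_monoid : monoid_morphism (@tens_assoc k A B C).
Proof.
split; first by rewrite -[1]tpure1 -[X in X *t _]tpure1 tens_assocE.
move=> x y; elim/tens_ind: x => [|p c x ih]; first by rewrite mul0r linear0 mul0r.
rewrite mulrDl !linearD /= ih mulrDl; congr (_ + _) => {x ih}.
elim/tens_ind: y => [|p' c' y ih]; first by rewrite mulr0 linear0 mulr0.
rewrite mulrDr !linearD /= ih mulrDr; congr (_ + _) => {y ih}.
rewrite tpureM.
elim/tens_ind: p => [|a b x ih]; first by rewrite mul0r !linear0l linear0 mul0r.
rewrite mulrDl !linearDl !linearD /= ih mulrDl; congr (_ + _) => {x ih}.
elim/tens_ind: p' => [|a' b' y ih]; first by rewrite mulr0 !linear0l linear0 mulr0.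
rewrite mulrDr !linearDl !linearD /= ih mulrDr; congr (_ + _) => {y ih}.
by rewrite tpureM !tens_assocE !tpureM.
Qed.
HB.instance Definition _ := GRing.isMonoidMorphism.Build
  ((A ⊗ B) ⊗ C) (A ⊗ (B ⊗ C)) (@tens_assoc k A B C) tens_assoc_monoid.
End TensAssocMorphism.

Section Multiplication.
Variables (k : fieldType) (A : algType k).

Definition mul_pure (a b : A) : A := a * b.
Fact mul_pure_bilin : bilin mul_pure.
Proof.
split=> [b c a a' | a c b b']; rewrite /mul_pure /=.
  by rewrite mulrDl scalerAl.
by rewrite mulrDr scalerAr.
Qed.
HB.instance Definition _ :=
  bilinear_isBilinear.Build k A A A *:%R *:%R mul_pure mul_pure_bilin.

Definition mul_map : A ⊗ A -> A := tens_lift mul_pure.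
HB.instance Definition _ := GRing.Linear.on mul_map.
End Multiplication.

Record hopf_algebra (k : fieldType) (H : algType k) := HopfAlgebra {
  comul : {lrmorphism H -> H ⊗ H};
  counit : {lrmorphism H -> k^o};
  antipode : {linear H -> H};
  comul_coassoc : forall h,
    tens_assoc (tens_map comul idfun (comul h)) = tens_map idfun comul (comul h);
  counit_left : forall h, tens_map counit idfun (comul h) = 1 *t h;
  counit_right : forall h, tens_map idfun counit (comul h) = h *t 1;
  antipode_left : forall h,
    mul_map (tens_map antipode idfun (comul h)) = (counit h : k)%:A;
  antipode_right : forall h,
    mul_map (tens_map idfun antipode (comul h)) = (counit h : k)%:A
}.

Section Comodules.
Variables (k : fieldType) (H : algType k) (hH : hopf_algebra H).

(* The coaction is an algebra morphism, which is what it means for the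
   multiplication and unit to be comodule maps. *)
Record left_comodule_algebra (T : algType k) (rho : {lrmorphism T -> H ⊗ T}) :
    Prop := LeftComoduleAlgebra {
  lcoact_coassoc : forall t,
    tens_assoc (tens_map (comul hH) idfun (rho t)) = tens_map idfun rho (rho t);
  lcoact_counit : forall t, tens_map (counit hH) idfun (rho t) = 1 *t t
}.

Record right_comodule_algebra (A : algType k) (rho : {lrmorphism A -> A ⊗ H}) :
    Prop := RightComoduleAlgebra {
  rcoact_coassoc : forall a,
    tens_assoc (tens_map rho idfun (rho a)) = tens_map idfun (comul hH) (rho a);
  rcoact_counit : forall a, tens_map idfun (counit hH) (rho a) = a *t 1
}.

Record left_torsor (T : algType k) (rho : {lrmorphism T -> H ⊗ T}) : Prop :=
  LeftTorsor {
  torsor_comodule : left_comodule_algebra rho;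
  torsor_iso : exists phi : {linear T -> H},
    bijective phi /\ forall t, comul hH (phi t) = tens_map idfun phi (rho t);
  torsor_coinv : forall t, rho t = 1 *t t <-> exists c : k, t = c%:A;
  torsor_bij : bijective (fun x : T ⊗ T =>
    tens_map idfun (@mul_map k T) (tens_assoc (tens_map rho idfun x)))
}.

(* rho W lies in W ⊗ H, seen inside A ⊗ H. *)
Definition subcomodule (A : algType k) (rho : {lrmorphism A -> A ⊗ H})
    (W : set A) : Prop :=
  forall a, W a -> exists s : seq (A * H),
    (forall p, p \in s -> W p.1) /\ rho a = \sum_(p <- s) p.1 *t p.2.

End Comodules.

(* An N-grading of A, given by the projections [hcomp i] of A onto its
   homogeneous components A_i. *)
Record grading (k : fieldType) (A : algType k) := Grading {
  hcomp : nat -> {linear A -> A};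
  hcomp_comp : forall i j a, hcomp i (hcomp j a) = if i == j then hcomp j a else 0;
  hcomp_sum : forall a, exists n, a = \sum_(i < n) hcomp i a;
  hcomp_one : hcomp 0%N 1 = 1;
  hcomp_mul : forall i j a b,
    hcomp i a = a -> hcomp j b = b -> hcomp (i + j)%N (a * b) = a * b
}.

Definition homog (k : fieldType) (A : algType k) (gA : grading A) (i : nat) :
    set A :=
  fun a => hcomp gA i a = a.

Record connected_graded_comodule_algebra (k : fieldType) (H : algType k)
    (hH : hopf_algebra H) (A : algType k) (gA : grading A)
    (rho : {lrmorphism A -> A ⊗ H}) : Prop := ConnectedGradedComoduleAlgebra {
  cgca_connected : forall a, homog gA 0 a <-> exists c : k, a = c%:A;
  cgca_comodule : right_comodule_algebra hH rho;
  cgca_sub : forall i, subcomodule rho (homog gA i)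
}.

Section Cotensor.
Variables (k : fieldType) (H A T : algType k).
Variables (rhoA : {lrmorphism A -> A ⊗ H}) (rhoT : {lrmorphism T -> H ⊗ T}).

Definition cotensor_pred : {pred A ⊗ T} := fun x =>
  tens_assoc (tens_map rhoA idfun x) == tens_map idfun rhoT x.

Record cotensor := Cotensor {
  cotensor_val : A ⊗ T;
  _ : cotensor_val \in cotensor_pred
}.

HB.instance Definition _ := [isSub for cotensor_val].
HB.instance Definition _ := [Choice of cotensor by <:].

Fact cotensor_closed : GRing.subsemialg_closed cotensor_pred.
Proof.
rewrite /cotensor_pred; split.
- by rewrite unfold_in !rmorph1.
- split=> [|x y]; rewrite !unfold_in ?linear0 //.
  by rewrite !linearD /= => /eqP -> /eqP ->.
- by move=> c x; rewrite !unfold_in !linearZ /= => /eqP ->.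
- by move=> x y; rewrite !unfold_in !rmorphM /= => /eqP -> /eqP ->.
Qed.
HB.instance Definition _ := GRing.SubChoice_isSubAlgebra.Build k (A ⊗ T)
  cotensor_pred cotensor cotensor_closed.

End Cotensor.

Section CotensorGrading.
Variables (k : fieldType) (H A T : algType k).
Variables (rhoA : {lrmorphism A -> A ⊗ H}) (rhoT : {lrmorphism T -> H ⊗ T}).
Variables (gA : grading A) (rho_sub : forall i, subcomodule rhoA (homog gA i)).

Fact hcomp_coact i a : rhoA (hcomp gA i a) = tens_map (hcomp gA i) idfun (rhoA a).
Proof.
have hom j b : homog gA j b ->
    tens_map (hcomp gA i) idfun (rhoA b) = if i == j then rhoA b else 0.
  move=> /rho_sub [s [hs ->]]; rewrite linear_sum /=.
  case: ifPn => [/eqP ij|nij].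
    apply: eq_big_seq => p /hs ps.
    by rewrite tens_mapE ij /= ps.
  rewrite big_seq big1 // => p /hs ps.
  by rewrite tens_mapE /= -ps hcomp_comp (negbTE nij) linear0l.
have [n aE] := hcomp_sum gA a; rewrite {1 2}aE !linear_sum /=.
apply: eq_bigr => j _.
rewrite (hom j); last by rewrite /homog hcomp_comp eqxx.
by rewrite hcomp_comp; case: ifP => // _; rewrite linear0.
Qed.

Fact cotensor_comp_closed i (x : cotensor rhoA rhoT) :
  tens_map (hcomp gA i) idfun (cotensor_val x) \in cotensor_pred rhoA rhoT.
Proof.
case: x => x /= /[!unfold_in] /eqP xP; apply/eqP.
transitivity (tens_map (hcomp gA i) idfun (tens_map idfun rhoT x)); last first.
  elim/tens_ind: {xP} x => [|a t x ih]; first by rewrite !linear0.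
  by rewrite !linearD /= ih !tens_mapE.
rewrite -xP; elim/tens_ind: {xP} x => [|a t x ih]; first by rewrite !linear0.
rewrite !linearD /= ih !tens_mapE /= hcomp_coact; congr (_ + _) => {x ih}.
elim/tens_ind: (rhoA a) => [|b h x ih]; first by rewrite !(linear0, linear0l).
by rewrite !(linearD, linearDl) /= ih !(tens_mapE, tens_assocE).
Qed.

Definition cotensor_comp (i : nat) (x : cotensor rhoA rhoT) :
  cotensor rhoA rhoT := Cotensor (cotensor_comp_closed i x).
Fact cotensor_comp_linear i : linear (cotensor_comp i).
Proof.
move=> c x y; apply: val_inj; rewrite linearP /= linearP.
by [].
Qed.
HB.instance Definition _ i := GRing.isLinear.Build k (cotensor rhoA rhoT)
  (cotensor rhoA rhoT) *:%R (cotensor_comp i) (cotensor_comp_linear i).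

Fact cotensor_comp_comp i j x :
  cotensor_comp i (cotensor_comp j x) = if i == j then cotensor_comp j x else 0.
Proof.
apply: val_inj; rewrite [RHS]fun_if raddf0 /=.
elim/tens_ind: (cotensor_val x) => [|a t y ih].
  by rewrite !linear0; case: eqP.
rewrite !linearD /= ih !tens_mapE /= hcomp_comp.
by case: eqP => // _; rewrite linear0l addr0.
Qed.

Fact hcomp_sum_ge (a : A) : exists n, forall m, (n <= m)%N ->
  a = \sum_(i < m) hcomp gA i a.
Proof.
have [n aE] := hcomp_sum gA a; exists n => m nm.
rewrite {1}aE (big_ord_widen _ (fun i => hcomp gA i a) nm) big_mkcond /=.
apply: eq_bigr => i _; case: ifPn => //; rewrite -leqNgt => ni.
rewrite aE linear_sum big1 //= => j _; rewrite hcomp_comp ifN //.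
by rewrite neq_ltn (leq_trans (ltn_ord j) ni) orbT.
Qed.

Fact cotensor_comp_sum x : exists n, x = \sum_(i < n) cotensor_comp i x.
Proof.
have [n nP] : exists n, forall m, (n <= m)%N -> cotensor_val x =
    \sum_(i < m) tens_map (hcomp gA i) idfun (cotensor_val x).
  elim/tens_ind: (cotensor_val x) => [|a t y [n nP]].
    by exists 0%N => m _; rewrite big1 // => i _; rewrite linear0.
  have [n' n'P] := hcomp_sum_ge a; exists (maxn n n') => m.
  rewrite geq_max => /andP[nm n'm].
  under eq_bigr do rewrite linearD /= tens_mapE /=.
  by rewrite big_split /= -nP // -linear_sumlz -n'P.
exists n; apply: val_inj; rewrite raddf_sum /= {1}(nP n) //.
Qed.

Fact cotensor_comp_one : cotensor_comp 0 1 = 1.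
Proof.
apply: val_inj.
transitivity (tens_map (hcomp gA 0) (@idfun T) (1 *t 1)); first by [].
by rewrite tens_mapE /= hcomp_one.
Qed.

Fact cotensor_comp_mul i j x y : cotensor_comp i x = x ->
  cotensor_comp j y = y -> cotensor_comp (i + j)%N (x * y) = x * y.
Proof.
move=> /(congr1 val); rewrite /= => xi /(congr1 val); rewrite /= => yj.
apply: val_inj; transitivity (tens_map (hcomp gA (i + j)) idfun
  (cotensor_val x * cotensor_val y)); first by [].
transitivity (cotensor_val x * cotensor_val y); last by [].
rewrite -xi -yj.
elim/tens_ind: (cotensor_val x) => [|a t z ih].
  by rewrite !linear0 !mul0r linear0.
rewrite !linearD /= !mulrDl linearD /= ih; congr (_ + _) => {z ih}.
elim/tens_ind: (cotensor_val y) => [|b u z ih].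
  by rewrite !linear0 !mulr0 linear0.
rewrite !linearD /= !mulrDr linearD /= ih; congr (_ + _) => {z ih}.
rewrite !tens_mapE tpureM tens_mapE /= hcomp_mul //.
  by rewrite hcomp_comp eqxx.
by rewrite hcomp_comp eqxx.
Qed.

Definition cotensor_grading : grading (cotensor rhoA rhoT) :=
  @Grading k (cotensor rhoA rhoT) (fun i => cotensor_comp i)
    cotensor_comp_comp cotensor_comp_sum cotensor_comp_one cotensor_comp_mul.

End CotensorGrading.

(* A Z-graded left A-module; [gcomp j] projects onto the degree j part. *)
Record gmod (k : fieldType) (A : algType k) (gA : grading A) := Gmod {
  gmod_car :> lmodType A;
  gcomp : int -> {additive gmod_car -> gmod_car};
  gcomp_comp : forall i j m,
    gcomp i (gcomp j m) = if i == j then gcomp j m else 0;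
  gcomp_sum : forall m, exists s : seq int,
    uniq s /\ m = \sum_(i <- s) gcomp i m;
  gcomp_scale : forall (i : nat) (j : int) a m,
    homog gA i a -> gcomp j m = m -> gcomp (i%:Z + j) (a *: m) = a *: m
}.

Section GradedModules.
Variables (k : fieldType) (A : algType k) (gA : grading A).
Implicit Types (M N I : gmod gA).

Definition ghomog M (j : int) : set M := fun m => gcomp M j m = m.

Definition finitely_generated (M : lmodType A) : Prop :=
  exists (r : nat) (g : 'I_r -> M),
    forall m, exists c : 'I_r -> A, m = \sum_l c l *: g l.

(* The gshift N(d), with N(d)_j = N_(d + j) *)
Section Shift.
Variables (N : gmod gA) (d : int).
Fact shift_comp i j m : gcomp N (d + i) (gcomp N (d + j) m) =
  if i == j then gcomp N (d + j) m else 0.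
Proof. by rewrite gcomp_comp (inj_eq (addrI d)). Qed.
Fact shift_sum m : exists s : seq int,
  uniq s /\ m = \sum_(i <- s) gcomp N (d + i) m.
Proof.
have [s [us mE]] := gcomp_sum m; exists [seq i - d | i <- s]; split.
  by rewrite map_inj_uniq //; exact: addIr.
by rewrite big_map {1}mE; apply: eq_bigr => i _; rewrite addrC subrK.
Qed.
Fact shift_scale (i : nat) (j : int) a m : homog gA i a ->
  gcomp N (d + j) m = m -> gcomp N (d + (i%:Z + j)) (a *: m) = a *: m.
Proof. by move=> ai mj; rewrite addrCA gcomp_scale. Qed.
Definition gshift : gmod gA := @Gmod k A gA N (fun j => gcomp N (d + j))
  shift_comp shift_sum shift_scale.
End Shift.

Definition gmorphism M N (f : M -> N) : Prop :=
  linear f /\ forall j m, ghomog j m -> ghomog j (f m).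

(* The elements of the sum over d in D of Hom (M, N(d)), as maps M -> N; the sum
   is direct, as maps of distinct degrees are independent. *)
Definition in_gHom (D : set int) M N (f : M -> N) : Prop :=
  exists (s : seq int) (g : int -> M -> N),
    (forall d, d \in s -> D d /\ gmorphism (g d : M -> gshift N d)) /\
    forall m, f m = \sum_(d <- s) g d m.

Definition gHom M N (f : M -> N) : Prop := in_gHom setT f.

Definition ginjective I : Prop :=
  forall M N (i : M -> N) (g : M -> I),
    gmorphism i -> injective i -> gmorphism g ->
    exists h : N -> I, gmorphism h /\ forall m, h (i m) = g m.

Record injective_resolution N := InjectiveResolution {
  res_obj : nat -> gmod gA;
  res_aug : N -> res_obj 0;
  res_d : forall i, res_obj i -> res_obj i.+1;
  res_aug_morphism : gmorphism res_aug;
  res_d_morphism : forall i, gmorphism (@res_d i);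
  res_injective : forall i, ginjective (res_obj i);
  res_aug_injective : injective res_aug;
  res_exact0 : forall x, res_d x = 0 <-> exists m, x = res_aug m;
  res_exact : forall i (x : res_obj i.+1),
    res_d x = 0 <-> exists y : res_obj i, x = res_d y
}.

Definition trunc_ge (n : nat) : {pred A} :=
  fun a => [forall i : 'I_n, hcomp gA i a == 0].

Lemma trunc_geP n a :
  reflect (forall i, (i < n)%N -> hcomp gA i a = 0) (a \in trunc_ge n).
Proof.
apply: (iffP forallP) => [h i lt_in|h i]; last by rewrite h.
exact/eqP/(h (Ordinal lt_in)).
Qed.

Fact trunc_ge_zmod n : zmod_closed (trunc_ge n).
Proof.
split=> [|a b /trunc_geP an /trunc_geP bn]; apply/trunc_geP => i lt_in.
  by rewrite linear0.
by rewrite linearB /= an // bn // subr0.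
Qed.
HB.instance Definition _ n :=
  GRing.isZmodClosed.Build A (trunc_ge n) (trunc_ge_zmod n).

Fact hcomp_mul_comp p q i a b : hcomp gA i (hcomp gA p a * hcomp gA q b) =
  if i == (p + q)%N then hcomp gA p a * hcomp gA q b else 0.
Proof.
have <- : hcomp gA (p + q) (hcomp gA p a * hcomp gA q b)
    = hcomp gA p a * hcomp gA q b by apply: hcomp_mul; rewrite hcomp_comp eqxx.
by rewrite hcomp_comp.
Qed.

Fact trunc_ge_ideal n a b c : b \in trunc_ge n -> a * b * c \in trunc_ge n.
Proof.
move=> /trunc_geP bn.
have h x y i : (i < n)%N -> (forall p q, (p + q < n)%N ->
    hcomp gA p x * hcomp gA q y = 0) -> hcomp gA i (x * y) = 0.
  move=> lt_in xy0.
  have [r xE] := hcomp_sum gA x; have [s yE] := hcomp_sum gA y.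
  rewrite xE yE mulr_suml linear_sum big1 //= => p _.
  rewrite mulr_sumr linear_sum big1 //= => q _.
  by rewrite hcomp_mul_comp; case: eqP => // ipq; apply: xy0; rewrite -ipq.
apply/trunc_geP => i lt_in; apply: (h) => // p q pq.
rewrite h ?mul0r //; first exact: leq_ltn_trans (leq_addr _ _) pq.
move=> p' q' pq'; rewrite (bn q') ?mulr0 //.
exact: leq_ltn_trans (leq_addl _ _) pq'.
Qed.

End GradedModules.

Section Truncation.
Variables (k : fieldType) (A : algType k) (gA : grading A) (n : nat).

(* A / A_(>= n), a left A-module through [trunc_scale]; [trunc_rmul] is its right
   A-action. *)
Definition trunc : Type := {ideal_quot (trunc_ge gA n)}.
HB.instance Definition _ := GRing.Zmodule.on trunc.

Definition trunc_pi (a : A) : trunc := \pi_{ideal_quot (trunc_ge gA n)} a.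
Definition trunc_repr (x : trunc) : A :=
  repr (x : {ideal_quot (trunc_ge gA n)}).

Fact trunc_pi_zmod : zmod_morphism trunc_pi.
Proof. exact: raddfB. Qed.
HB.instance Definition _ :=
  GRing.isZmodMorphism.Build A trunc trunc_pi trunc_pi_zmod.

Lemma trunc_reprK x : trunc_pi (trunc_repr x) = x.
Proof. exact: reprK. Qed.

Lemma trunc_eqP a b : trunc_pi a = trunc_pi b <-> a - b \in trunc_ge gA n.
Proof. by rewrite Quotient.idealrBE; split => [/eqP|/eqP]. Qed.

Definition trunc_scale (a : A) (x : trunc) : trunc :=
  trunc_pi (a * trunc_repr x).
Definition trunc_rmul (x : trunc) (a : A) : trunc :=
  trunc_pi (trunc_repr x * a).

Lemma trunc_scaleE a b : trunc_scale a (trunc_pi b) = trunc_pi (a * b).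
Proof.
apply/trunc_eqP; rewrite -mulrBr -[X in X \in _]mulr1.
by apply/trunc_ge_ideal/trunc_eqP/trunc_reprK.
Qed.
Lemma trunc_rmulE a b : trunc_rmul (trunc_pi b) a = trunc_pi (b * a).
Proof.
apply/trunc_eqP; rewrite -mulrBl -[X in X * a]mul1r.
by apply/trunc_ge_ideal/trunc_eqP/trunc_reprK.
Qed.

Fact trunc_scaleA a b x :
  trunc_scale a (trunc_scale b x) = trunc_scale (a * b) x.
Proof. by rewrite -(trunc_reprK x) !trunc_scaleE mulrA. Qed.
Fact trunc_scale1 : left_id 1 trunc_scale.
Proof. by move=> x; rewrite -(trunc_reprK x) trunc_scaleE mul1r. Qed.
Fact trunc_scaleDr : right_distributive trunc_scale +%R.
Proof.
move=> a x y; rewrite -(trunc_reprK x) -(trunc_reprK y).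
by rewrite -raddfD !trunc_scaleE mulrDr raddfD.
Qed.
Fact trunc_scaleDl x : {morph trunc_scale^~ x : a b / a + b}.
Proof. by move=> a b; rewrite /trunc_scale mulrDl raddfD. Qed.
HB.instance Definition _ := GRing.Zmodule_isLmodule.Build A trunc
  trunc_scaleA trunc_scale1 trunc_scaleDr trunc_scaleDl.

Definition trunc_comp (j : int) (x : trunc) : trunc :=
  if j is Posz i then trunc_pi (hcomp gA i (trunc_repr x)) else 0.

Lemma trunc_compE i a : trunc_comp (Posz i) (trunc_pi a) = trunc_pi (hcomp gA i a).
Proof.
apply/trunc_eqP; rewrite -linearB /=; apply/trunc_geP => j jn.
have /trunc_eqP/trunc_geP h := trunc_reprK (trunc_pi a).
by rewrite hcomp_comp; case: eqP => // <-; rewrite h.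
Qed.

Fact trunc_comp_zmod j : zmod_morphism (trunc_comp j).
Proof.
case: j => j x y /=; last by rewrite subr0.
rewrite -(trunc_reprK x) -(trunc_reprK y) -raddfB.
by rewrite -!/(trunc_comp (Posz j) _) !trunc_compE linearB raddfB.
Qed.
HB.instance Definition _ j := GRing.isZmodMorphism.Build trunc trunc
  (trunc_comp j) (trunc_comp_zmod j).

Fact trunc_comp_comp i j x :
  trunc_comp i (trunc_comp j x) = if i == j then trunc_comp j x else 0.
Proof.
case: j => j; last by rewrite raddf0; case: eqP.
case: i => i; last by [].
rewrite -(trunc_reprK x) !trunc_compE hcomp_comp.
by rewrite eqz_nat; case: eqP => // _; rewrite raddf0.
Qed.

Fact trunc_comp_sum x : exists s : seq int,
  uniq s /\ x = \sum_(i <- s) trunc_comp i x.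
Proof.
have [r aE] := hcomp_sum gA (trunc_repr x).
exists [seq Posz i | i <- iota 0 r]; split.
  by rewrite map_inj_uniq ?iota_uniq // => i j [].
rewrite -{1}(trunc_reprK x) aE raddf_sum big_map /=.
have -> : iota 0 r = index_iota 0 r by rewrite /index_iota subn0.
by rewrite big_mkord.
Qed.

Fact trunc_comp_scale (i : nat) (j : int) a x : homog gA i a ->
  trunc_comp j x = x -> trunc_comp (i%:Z + j) (a *: x) = a *: x.
Proof.
move=> ai; case: j => [j <-|j <-]; last by rewrite scaler0 raddf0.
rewrite -(trunc_reprK x) trunc_compE.
rewrite [a *: _]trunc_scaleE -PoszD trunc_compE hcomp_mul //.
by rewrite hcomp_comp eqxx.
Qed.

Definition truncM : gmod gA := @Gmod k A gA trunc (fun j => trunc_comp j)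
  trunc_comp_comp trunc_comp_sum trunc_comp_scale.

End Truncation.

Section PropertyChi.
Variables (k : fieldType) (A : algType k) (gA : grading A).

(* Ext^i (A/A_(>= n), N) is the i-th cohomology of the graded Hom complex
   gHom (A/A_(>= n), R), R an injective resolution of N in graded left modules.
   It does not depend on R, and [property_chi] ranges over all of them. *)
Section Ext.
Variables (n : nat) (N : gmod gA) (R : injective_resolution N).

Definition ext_cocycle i (f : truncM gA n -> res_obj R i) : Prop :=
  gHom f /\ forall x, res_d (f x) = 0.

Definition ext_coboundary i : (truncM gA n -> res_obj R i) -> Prop :=
  match i with
  | 0 => fun f => forall x, f x = 0
  | j.+1 => fun f => exists g : truncM gA n -> res_obj R j,
      gHom g /\ forall x, f x = res_d (g x)
  end.

Definition ext_degree_ge (d : nat) i (f : truncM gA n -> res_obj R i) : Prop :=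
  in_gHom (fun e => d%:Z <= e) f.

(* Finite generation of the subquotient Ext^i (A/A_(>= n), N)_(>= d), with A
   acting by (a f) x = f (x a). *)
Definition ext_ge_finitely_generated (i d : nat) : Prop :=
  exists (r : nat) (g : 'I_r -> truncM gA n -> res_obj R i),
    (forall l, ext_cocycle (g l) /\ ext_degree_ge d (g l)) /\
    forall f, ext_cocycle f -> ext_degree_ge d f ->
      exists a : 'I_r -> A,
        ext_coboundary (fun x => f x - \sum_l g l (trunc_rmul x (a l))).

End Ext.

Definition property_chi : Prop :=
  forall (i d : nat) (N : gmod gA), finitely_generated N ->
    exists n0 : nat, forall n, (n0 <= n)%N ->
      forall R : injective_resolution N, ext_ge_finitely_generated n R i d.

End PropertyChi.

Section RingConditions.
Variable A : nzRingType.

Definition left_ideal (I : set A) : Prop :=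
  [/\ I 0, forall x y, I x -> I y -> I (x + y) & forall a x, I x -> I (a * x)].
Definition right_ideal (I : set A) : Prop :=
  [/\ I 0, forall x y, I x -> I y -> I (x + y) & forall a x, I x -> I (x * a)].

Definition left_noetherian : Prop := forall I, left_ideal I ->
  exists (r : nat) (g : 'I_r -> A), (forall l, I (g l)) /\
    forall x, I x -> exists c : 'I_r -> A, x = \sum_l c l * g l.
Definition right_noetherian : Prop := forall I, right_ideal I ->
  exists (r : nat) (g : 'I_r -> A), (forall l, I (g l)) /\
    forall x, I x -> exists c : 'I_r -> A, x = \sum_l g l * c l.
Definition noetherian : Prop := left_noetherian /\ right_noetherian.

Definition projective (P : lmodType A) : Prop :=
  forall (M N : lmodType A) (p : {linear M -> N}) (f : {linear P -> N}),
    (forall y, exists x, p x = y) ->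
    exists h : {linear P -> M}, forall x, p (h x) = f x.

Definition projective_dimension_le (M : lmodType A) (d : nat) : Prop :=
  exists (P : nat -> lmodType A) (delta : forall i, {linear P i.+1 -> P i})
      (aug : {linear P 0 -> M}),
    [/\ (forall i, projective (P i)) /\
          forall i, (d < i)%N -> forall x : P i, x = 0,
        forall m, exists x, aug x = m,
        forall x, aug x = 0 <-> exists y, x = delta 0 y
      & forall i x, delta i x = 0 <-> exists y, x = delta i.+1 y].

(* This is the left global dimension; it equals the right one for a two-sided
   noetherian ring. *)
Definition finite_global_dimension : Prop :=
  exists d, forall M : lmodType A, projective_dimension_le M d.

End RingConditions.

(* Main.v *)
From HB Require Import structures.
Require Import Defs.
From mathcomp Require Import all_boot order ssralg ssrnum ssrint falgebra.
From mathcomp Require Import sesquilinear matrix vector boolp classical_sets.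
Local Open Scope ring_scope.

(** Write B for the cotensor algebra and S = A ⊗ T, which contains both A and B. The
    Galois map of the torsor makes S free as a left B-module on a basis (t_j) of T, and
    S is free as a right A-module on the same basis, so that
    [t_j a = sum_l X(a)_jl t_l] and [b t_j = sum_l t_l Z(b)_lj] for graded morphisms X
    from A to matrices over B and Z from B to matrices over A. The functor
    N |-> Hom_B(S, N), which is N^r with A acting through X, is exact and preserves
    injectives, as its left adjoint S ⊗_A - (which is M^r with B acting through Z) is
    exact. Hence Ext_A(A/A_(>=n), Hom_B(S, N)) = Ext_B(S/S_(>=n), N), and this maps
    onto Ext_B(B/B_(>=n), N), because B/B_(>=n) is a direct summand of the left
    B-module S/S_(>=n). Finite generation over A passes to the image, as S is finite
    over B. What remains is that Hom_B(S, B) is a finitely generated A-module; it is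
    generated by the B-linear extensions to S of the linear forms on T. This follows
    from the Miyashita-Ulbrich action of H on T. *)

Set Implicit Arguments.
Unset Strict Implicit.
Unset Printing Implicit Defensive.
Import GRing.Theory.

(** * Graded morphisms into matrices and the modules they define *)

Record graded_mx_morphism (k : fieldType) (A B : algType k) (gA : grading A)
    (gB : grading B) (r : nat) := GradedMxMorphism {
  gmx_fun :> {rmorphism A -> 'M[B]_r.+1};
  gmx_hcomp : forall i a, gmx_fun (hcomp gA i a) = map_mx (hcomp gB i) (gmx_fun a)
}.

Lemma gcomp_eq0 (k : fieldType) (A : algType k) (gA : grading A) (M : gmod gA)
    (s : seq int) (m : M) j :
  m = \sum_(i <- s) gcomp M i m -> j \notin s -> gcomp M j m = 0.
Proof.
move=> {1}-> js; rewrite raddf_sum big_seq big1 // => i si /=.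
by rewrite gcomp_comp; case: eqP => // ji; rewrite ji si in js.
Qed.

(** Serves to give the finitely many entries of a vector a common list of degrees. *)
Lemma gcomp_sum_sub (k : fieldType) (A : algType k) (gA : grading A) (M : gmod gA)
    (s s' : seq int) (m : M) : uniq s -> uniq s' -> {subset s <= s'} ->
  m = \sum_(i <- s) gcomp M i m -> m = \sum_(i <- s') gcomp M i m.
Proof.
move=> us us' ss' mE; rewrite (bigID (mem s)) /= [X in _ + X]big1 ?addr0; last first.
  by move=> i; exact: gcomp_eq0.
rewrite -big_filter {1}mE; apply: perm_big; apply: uniq_perm => //.
  exact: filter_uniq.
by move=> i; rewrite mem_filter; case: (boolP (i \in s)) => //= /ss' ->.
Qed.

(* For X defined by [t_j a = sum_l X(a)_jl t_l], this is Hom_B(S, N), a map f being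
   recorded by its values at the t_j; for Z defined by [b t_j = sum_l t_l Z(b)_lj],
   it is S ⊗_A M, the vector m standing for the sum of the [t_j ⊗ m_j]. *)
Definition mxres (k : fieldType) (A B : algType k) (gA : grading A)
    (gB : grading B) (r : nat) (X : graded_mx_morphism gA gB r) (N : gmod gB) :
  Type := {ffun 'I_r.+1 -> N}.

Section Restriction.
Variables (k : fieldType) (A B : algType k) (gA : grading A) (gB : grading B).
Variables (r : nat) (X : graded_mx_morphism gA gB r) (N : gmod gB).

Local Notation mxres := (mxres X N).
HB.instance Definition _ := GRing.Zmodule.copy mxres {ffun 'I_r.+1 -> N}.

Definition mxres_scale (a : A) (v : mxres) : mxres :=
  [ffun j => \sum_l X a j l *: v l].

Fact mxres_scaleA a b v :
  mxres_scale a (mxres_scale b v) = mxres_scale (a * b) v.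
Proof.
apply/ffunP => j; rewrite !ffunE rmorphM /=.
under eq_bigr do rewrite ffunE scaler_sumr.
rewrite exchange_big; apply: eq_bigr => l _ /=.
by rewrite mxE scaler_suml; apply: eq_bigr => p _; rewrite scalerA.
Qed.
Fact mxres_scale1 : left_id 1 mxres_scale.
Proof.
move=> v; apply/ffunP => j; rewrite ffunE rmorph1 (bigD1 j) //= big1.
  by rewrite mxE eqxx scale1r addr0.
by move=> l lj; rewrite mxE eq_sym (negbTE lj) scale0r.
Qed.
Fact mxres_scaleDr : right_distributive mxres_scale +%R.
Proof.
move=> a u v; apply/ffunP => j; rewrite !ffunE -big_split.
by apply: eq_bigr => l _; rewrite ffunE scalerDr.
Qed.
Fact mxres_scaleDl v : {morph mxres_scale^~ v : a b / a + b}.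
Proof.
move=> a b; apply/ffunP => j; rewrite !ffunE -big_split.
by apply: eq_bigr => l _; rewrite rmorphD mxE scalerDl.
Qed.
HB.instance Definition _ := GRing.Zmodule_isLmodule.Build A mxres
  mxres_scaleA mxres_scale1 mxres_scaleDr mxres_scaleDl.

Lemma mxresZ a (v : mxres) j : (a *: v) j = \sum_l X a j l *: v l.
Proof. by rewrite [_ *: _]/(mxres_scale a v) ffunE. Qed.

Definition mxres_comp (i : int) (v : mxres) : mxres :=
  [ffun j => gcomp N i (v j)].
Fact mxres_comp_zmod i : zmod_morphism (mxres_comp i).
Proof. by move=> u v; apply/ffunP => j; rewrite !ffunE raddfB. Qed.
HB.instance Definition _ i := GRing.isZmodMorphism.Build mxres mxres
  (mxres_comp i) (mxres_comp_zmod i).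

Fact mxres_comp_comp i j v :
  mxres_comp i (mxres_comp j v) = if i == j then mxres_comp j v else 0.
Proof.
by apply/ffunP => l; rewrite !ffunE gcomp_comp; case: eqP => // _; rewrite !ffunE.
Qed.

Fact mxres_comp_sum v : exists s : seq int,
  uniq s /\ v = \sum_(i <- s) mxres_comp i v.
Proof.
have /choice[s sP] := fun j => gcomp_sum (v j).
exists (undup (flatten [seq s j | j <- enum 'I_r.+1])); split.
  exact: undup_uniq.
apply/ffunP => j; rewrite sum_ffunE; under eq_bigr do rewrite ffunE.
have [us {}sP] := sP j; apply: gcomp_sum_sub sP => //; first exact: undup_uniq.
move=> i si; rewrite mem_undup; apply/flatten_mapP; exists j => //.
by rewrite mem_enum.
Qed.

Fact mxres_comp_scale (i : nat) (j : int) a v : homog gA i a ->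
  mxres_comp j v = v -> mxres_comp (i%:Z + j) (a *: v) = a *: v.
Proof.
move=> ai vj; apply/ffunP => p; rewrite ffunE mxresZ raddf_sum.
apply: eq_bigr => l _; apply: gcomp_scale.
  by rewrite /homog -[in RHS]ai gmx_hcomp mxE.
by rewrite -[in RHS]vj ffunE.
Qed.

Definition gmxres : gmod gA := @Gmod k A gA mxres (fun i => mxres_comp i)
  mxres_comp_comp mxres_comp_sum mxres_comp_scale.

End Restriction.

Lemma linear_pack (R : pzRingType) (U V : lmodType R) (f : U -> V) :
  linear f -> exists g : {linear U -> V}, f = g :> (U -> V).
Proof. by move=> fl; exists (HB.pack_for {linear U -> V} f (GRing.isLinear.Build R U V *:%R f fl)). Qed.

(** * The functor Hom_B(S, -) on injectives and on resolutions *)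

Section Transfer.
Variables (k : fieldType) (A B : algType k) (gA : grading A) (gB : grading B).
Variables (r : nat) (X : graded_mx_morphism gA gB r) (Z : graded_mx_morphism gB gA r).
(** Expanding b t_j = sum_l t_l Z(b)_lj once more by X gives sum_(l,p) X(Z(b)_lj)_lp t_p; comparing
    coefficients of t_p yields [XZ]. [ZX] arises from t_j a in the same way. *)
Hypothesis XZ : forall b j p, \sum_l X (Z b l j) l p = if j == p then b else 0.
Hypothesis ZX : forall a l j, \sum_p Z (X a j p) l p = if l == j then a else 0.

(** B-linearity of the evaluation S ⊗_A Hom_B(S, N) -> N, t_q ⊗ f |-> f(t_q): the left side
    evaluates b t_q ⊗ v = sum_j t_j ⊗ Z(b)_jq v. *)
Lemma mxres_trace (N : gmod gB) b q (v : gmxres X N) :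
  \sum_j ((Z b j q *: v : gmxres X N) : mxres X N) j = b *: (v : mxres X N) q.
Proof.
under eq_bigr do rewrite mxresZ.
rewrite exchange_big /=; under eq_bigr do rewrite -scaler_suml XZ.
rewrite (bigD1 q) //= eqxx big1 ?addr0 // => p pq.
by rewrite eq_sym (negbTE pq) scale0r.
Qed.

(** The tensor t_j ⊗ m in S ⊗_A M. *)
Definition unit_vec (M : gmod gA) (j : 'I_r.+1) (m : M) : gmxres Z M :=
  [ffun l => if l == j then m else 0] : mxres Z M.

(* A map g from M to Hom_B(S, I) corresponds to the map sum_j t_j ⊗ m_j |-> sum_j g(m_j)_j
   from S ⊗_A M to I. *)
Lemma ginjective_mxres (I : gmod gB) : ginjective I -> ginjective (gmxres X I).
Proof.
move=> injI M N i g [il ihom] iinj [gl ghom].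
have [iL iE] := linear_pack il; have [gL gE] := linear_pack gl; subst i g.
pose up m : mxres Z N := [ffun j => iL ((m : mxres Z M) j)].
pose h m := \sum_j (gL ((m : mxres Z M) j) : mxres X I) j.
have up_mor : gmorphism (up : gmxres Z M -> gmxres Z N).
  split=> [b m m'|j m mj].
    apply/ffunP => p; rewrite !ffunE linearD linear_sum; congr (_ + _).
    by apply: eq_bigr => q _; rewrite ?ffunE linearZ.
  apply/ffunP => p; rewrite !ffunE; apply: ihom.
  by rewrite /ghomog -{2}mj ffunE.
have h_mor : gmorphism (h : gmxres Z M -> I).
  split=> [b m m'|j m mj].
    rewrite /h; under eq_bigr do rewrite ffunE linearD ffunE mxresZ linear_sum sum_ffunE.
    rewrite big_split exchange_big scaler_sumr /=; congr (_ + _).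
    apply: eq_bigr => q _; rewrite -mxres_trace.
    by apply: eq_bigr => p _; rewrite linearZ.
  rewrite /ghomog raddf_sum; apply: eq_bigr => p _.
  have mp : ghomog j ((m : mxres Z M) p) by rewrite /ghomog -{2}mj ffunE.
  by have /ffunP/(_ p) := ghom _ _ mp; rewrite ffunE.
have up_inj : injective up.
  by move=> m m' /ffunP e; apply/ffunP => p; have := e p; rewrite !ffunE => /iinj.
have [h' [[h'l h'hom] h'E]] := injI _ _ _ _ up_mor up_inj h_mor.
have [h'L eh'] := linear_pack h'l; subst h'.
(* The map N -> Hom_B(S, I) adjoint to h': the image of n takes the value h'(t_j ⊗ n) at t_j. *)
exists (fun n => [ffun j => h'L (unit_vec j n)]); split; last first.
  move=> m; apply/ffunP => j; rewrite ffunE.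
  have -> : unit_vec j (iL m) = up (unit_vec j m).
    by apply/ffunP => p; rewrite !ffunE; case: eqP => // _; rewrite linear0.
  rewrite h'E /h (bigD1 j) //= ffunE eqxx big1 ?addr0 // => p pj.
  by rewrite ffunE (negbTE pj) linear0 ffunE.
split=> [a n n'|j n nj].
  (* A-linearity is t_j ⊗ a n = t_j a ⊗ n = sum_p X(a)_jp (t_p ⊗ n), which [ZX] confirms coordinate
     by coordinate. *)
  apply/ffunP => j; rewrite !ffunE.
  under [X in _ = X + _]eq_bigr do rewrite ffunE -linearZ.
  rewrite -linear_sum -linearD; congr (h'L _).
  apply/ffunP => l; rewrite !ffunE sum_ffunE.
  transitivity (\sum_p Z (X a j p) l p *: n + (if l == j then n' else 0)).
    by rewrite -scaler_suml ZX; case: eqP; rewrite ?scale0r ?addr0.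
  congr (_ + _); apply: eq_bigr => p _; rewrite mxresZ (bigD1 p) //= ffunE eqxx.
  by rewrite big1 ?addr0 // => q qp; rewrite ffunE (negbTE qp) scaler0.
apply/ffunP => p; rewrite !ffunE; apply: h'hom.
by apply/ffunP => l; rewrite !ffunE; case: eqP => // _; rewrite raddf0.
Qed.

Section Resolution.
Variables (N : gmod gB) (R : injective_resolution N).

Definition mxres_map (M M' : gmod gB) (f : M -> M') (v : gmxres X M) : gmxres X M' :=
  [ffun j => f ((v : mxres X M) j)] : mxres X M'.

Lemma mxres_map_morphism (M M' : gmod gB) (f : M -> M') :
  gmorphism f -> gmorphism (mxres_map f).
Proof.
move=> [fl fhom]; have [fL fE] := linear_pack fl; subst f; split=> [a v v'|j v vj].
  apply/ffunP => p; rewrite !ffunE linearD linear_sum; congr (_ + _).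
  by apply: eq_bigr => q _; rewrite ?ffunE linearZ.
by apply/ffunP => p; rewrite !ffunE; apply: fhom; rewrite /ghomog -{2}vj ffunE.
Qed.

Lemma mxres_map_inj (M M' : gmod gB) (f : M -> M') :
  injective f -> injective (mxres_map f).
Proof.
by move=> fi v v' /ffunP e; apply/ffunP => p; have := e p; rewrite !ffunE => /fi.
Qed.

Lemma mxres_map_exact (M M' M'' : gmod gB) (f : M -> M') (g : M' -> M'') :
  (forall x, g x = 0 <-> exists m, x = f m) ->
  forall v, mxres_map g v = 0 <-> exists m, v = mxres_map f m.
Proof.
move=> fg v; split=> [/ffunP gv|[m ->]].
  have /choice[m mP] j : exists m, (v : mxres X M') j = f m.
    by apply/fg; have := gv j; rewrite !ffunE.
  by exists ([ffun j => m j] : mxres X M); apply/ffunP => j; rewrite !ffunE mP.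
by apply/ffunP => j; rewrite !ffunE; apply/fg; exists ((m : mxres X M) j).
Qed.

Definition mxres_resolution : injective_resolution (gmxres X N) :=
  @InjectiveResolution k A gA (gmxres X N)
    (fun i => gmxres X (res_obj R i)) (mxres_map (@res_aug _ _ _ _ R))
    (fun i => mxres_map (@res_d _ _ _ _ R i))
    (mxres_map_morphism (res_aug_morphism R))
    (fun i => mxres_map_morphism (res_d_morphism R i))
    (fun i => ginjective_mxres (@res_injective _ _ _ _ R i))
    (mxres_map_inj (@res_aug_injective _ _ _ _ R))
    (mxres_map_exact (@res_exact0 _ _ _ _ R))
    (fun i => mxres_map_exact (@res_exact _ _ _ _ R i)).

End Resolution.
End Transfer.

(** * Matrix coefficients modulo degrees at least n *)

Section TruncationMap.
Variables (k : fieldType) (A B : algType k) (gA : grading A) (gB : grading B).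
Variables (r : nat) (X : graded_mx_morphism gA gB r) (n : nat).

(** The coefficient of t_l in t_j x, taken in S/S_(>=n), the sum of the (B/B_(>=n)) t_l. With Z for
    X it is the coefficient of t_j in x t_l. *)
Definition mx_trunc (j l : 'I_r.+1) (x : trunc gA n) : trunc gB n :=
  trunc_pi gB n (X (trunc_repr x) j l).

(** The choice of representative is harmless: X commutes with the homogeneous projections, so it
    sends A_(>=n) to matrices over B_(>=n). *)
Lemma mx_truncE j l a : mx_trunc j l (trunc_pi gA n a) = trunc_pi gB n (X a j l).
Proof.
apply/trunc_eqP; have -> b c : X b j l - X c j l = X (b - c) j l.
  by rewrite raddfB !mxE.
have /trunc_eqP/trunc_geP h := trunc_reprK (trunc_pi gA n a).
by apply/trunc_geP => i /h/(congr1 X); rewrite gmx_hcomp raddf0 => /matrixP/(_ j l);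
  rewrite !mxE.
Qed.

Fact mx_trunc_zmod j l : zmod_morphism (mx_trunc j l).
Proof.
move=> x y; rewrite -(trunc_reprK x) -(trunc_reprK y) -raddfB !mx_truncE.
by rewrite rmorphB !mxE raddfB.
Qed.
HB.instance Definition _ j l := GRing.isZmodMorphism.Build (trunc gA n) (trunc gB n)
  (mx_trunc j l) (mx_trunc_zmod j l).

Lemma mx_trunc_comp i j l x :
  mx_trunc j l (trunc_comp i x) = trunc_comp i (mx_trunc j l x).
Proof.
case: i => i; last by rewrite raddf0.
by rewrite -(trunc_reprK x) trunc_compE !mx_truncE trunc_compE gmx_hcomp mxE.
Qed.

Lemma mx_truncZ j l a x :
  mx_trunc j l (a *: x) = \sum_p X a j p *: mx_trunc p l x.
Proof.
rewrite -(trunc_reprK x) [_ *: _]trunc_scaleE mx_truncE rmorphM mxE raddf_sum.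
by apply: eq_bigr => p _; rewrite mx_truncE [RHS]trunc_scaleE.
Qed.

Lemma mx_trunc_rmul j l x a :
  mx_trunc j l (trunc_rmul x a) = \sum_p trunc_rmul (mx_trunc j p x) (X a p l).
Proof.
rewrite -(trunc_reprK x) trunc_rmulE mx_truncE rmorphM mxE raddf_sum.
by apply: eq_bigr => p _; rewrite mx_truncE trunc_rmulE.
Qed.

End TruncationMap.

Lemma trunc_rmul_sum (k : fieldType) (A : algType k) (gA : grading A) (n : nat)
    (x : trunc gA n) (I : finType) (a : I -> A) :
  trunc_rmul x (\sum_i a i) = \sum_i trunc_rmul x (a i).
Proof. by rewrite /trunc_rmul mulr_sumr raddf_sum. Qed.

Lemma in_gHom_zmod (k : fieldType) (A : algType k) (gA : grading A) (D : set int)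
    (M N : gmod gA) (f : M -> N) : in_gHom D f -> zmod_morphism f.
Proof.
move=> [s [g [gP fE]]] x y; rewrite !fE -sumrB big_seq [RHS]big_seq.
apply: eq_bigr => d /gP[_ [gl _]].
by have := gl (-1) y x; rewrite !scaleN1r ![- _ + _]addrC.
Qed.

(** * Comparison of Ext over A and over B *)

Section ExtTransfer.
Variables (k : fieldType) (A B : algType k) (gA : grading A) (gB : grading B).
Variables (r : nat) (X : graded_mx_morphism gA gB r) (Z : graded_mx_morphism gB gA r).
Hypothesis XZ : forall b j p, \sum_l X (Z b l j) l p = if j == p then b else 0.
Hypothesis ZX : forall a l j, \sum_p Z (X a j p) l p = if l == j then a else 0.
Variable n : nat.

Section Maps.
Variables (I : gmod gB).

(* The map B/B_(>=n) -> I is composed with the projection of S/S_(>=n) onto the summand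
   (B/B_(>=n)) t_0. *)
Definition hom_up (f : truncM gB n -> I) (x : truncM gA n) : gmxres X I :=
  [ffun j => f (mx_trunc X j ord0 x)] : mxres X I.

(* The map S/S_(>=n) -> I adjoint to g, precomposed with y |-> y t_p. *)
Definition hom_down (p : 'I_r.+1) (g : truncM gA n -> gmxres X I)
  (y : truncM gB n) : I := \sum_j (g (mx_trunc Z j p y) : mxres X I) j.

Lemma hom_up_gHom D f : in_gHom D f -> in_gHom D (hom_up f).
Proof.
move=> [s [g [gP fE]]]; exists s, (fun d => hom_up (g d)); split; last first.
  move=> x; apply/ffunP => j; rewrite ffunE fE sum_ffunE.
  by apply: eq_bigr => d _; rewrite ffunE.
move=> d /gP[Dd [gl ghom]]; split=> //.
have [gL gE] := linear_pack gl; rewrite gE in ghom *.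
split=> [a x y|j x xj].
  apply/ffunP => p; rewrite !ffunE raddfD /= mx_truncZ linearD linear_sum.
  by congr (_ + _); apply: eq_bigr => q _; rewrite linearZ ffunE.
apply/ffunP => p; rewrite !ffunE; apply: ghom.
by rewrite /ghomog -[in RHS]xj mx_trunc_comp.
Qed.

Lemma hom_down_gHom D p g : in_gHom D g -> in_gHom D (hom_down p g).
Proof.
move=> [s [h [hP gE]]]; exists s, (fun d => hom_down p (h d)); split; last first.
  move=> y; rewrite /hom_down; under eq_bigr do rewrite gE sum_ffunE.
  exact: exchange_big.
move=> d /hP[Dd [hl hhom]]; split=> //.
have [hL hE] := linear_pack hl; rewrite hE in hhom *.
split=> [b x y|j y yj].
  rewrite /hom_down.
  under eq_bigr do rewrite raddfD /= mx_truncZ linearD ffunE linear_sum sum_ffunE.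
  rewrite big_split exchange_big scaler_sumr /=; congr (_ + _).
  apply: eq_bigr => q _; rewrite -(mxres_trace XZ).
  by apply: eq_bigr => l _; rewrite linearZ.
rewrite /ghomog raddf_sum; apply: eq_bigr => q _.
have zq : ghomog j (mx_trunc Z q p y : truncM gA n).
  by rewrite /ghomog -[in RHS]yj mx_trunc_comp.
by have /ffunP/(_ q) := hhom _ _ zq; rewrite ffunE.
Qed.

Lemma hom_downB p g h y :
  hom_down p (fun x => g x - h x) y = hom_down p g y - hom_down p h y.
Proof. by rewrite -sumrB; apply: eq_bigr => j _; rewrite !ffunE. Qed.

Lemma hom_down_sum p (J : finType) (g : J -> truncM gA n -> gmxres X I) y :
  hom_down p (fun x => \sum_i g i x) y = \sum_i hom_down p (g i) y.
Proof. by rewrite exchange_big; apply: eq_bigr => j _; rewrite sum_ffunE. Qed.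

(** The inclusion y |-> y t_0 of B/B_(>=n) into S/S_(>=n) is split by the coefficient at t_0, as
    [XZ] shows. This makes the map between the Ext groups surjective. *)
Lemma hom_downK f : zmod_morphism f -> hom_down ord0 (hom_up f) =1 f.
Proof.
move=> fz y.
pose fA := HB.pack_for {additive truncM gB n -> I} f (GRing.isZmodMorphism.Build _ _ f fz).
have fE : f = fA by []; rewrite fE /hom_down.
under eq_bigr do rewrite ffunE.
rewrite -raddf_sum; congr (fA _).
rewrite -(trunc_reprK y); under eq_bigr do rewrite !mx_truncE.
by rewrite -raddf_sum XZ eqxx.
Qed.

(** This is y t_0 a = sum_p y X(a)_0p t_p. It trades scalars from A for scalars from B, at the price
    of involving [hom_down p] for every p. *)
Lemma hom_down_rmul g a y : zmod_morphism g ->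
  hom_down ord0 (fun x => g (trunc_rmul x a)) y =
  \sum_p hom_down p g (trunc_rmul y (X a ord0 p)).
Proof.
move=> gz.
pose gM := HB.pack_for {additive truncM gA n -> gmxres X I} g
  (GRing.isZmodMorphism.Build _ _ g gz).
have gE : g = gM by []; rewrite gE /hom_down exchange_big.
apply: eq_bigr => j _.
rewrite -sum_ffunE -raddf_sum; congr ((gM _ : mxres X I) j).
under eq_bigr do rewrite mx_trunc_rmul.
rewrite exchange_big (bigD1 ord0) //= -trunc_rmul_sum ZX eqxx big1 ?addr0 // => q q0.
rewrite -trunc_rmul_sum ZX (negbTE q0) /trunc_rmul mulr0.
exact: raddf0.
Qed.

End Maps.

Variables (N : gmod gB) (R : injective_resolution N).

(** For generators g_l over A, the maps [hom_down p] of g_l generate over B: write [hom_up f] as a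
    combination of the g_l up to a coboundary, apply [hom_down ord0], and use [hom_downK] and
    [hom_down_rmul]. *)
Lemma ext_transfer i d :
  ext_ge_finitely_generated n (mxres_resolution XZ ZX R) i d ->
  ext_ge_finitely_generated n R i d.
Proof.
move=> [m [g [gP gen]]].
pose h (l : 'I_#|{: 'I_m * 'I_r.+1}|) : truncM gB n -> res_obj R i := hom_down (enum_val l).2 (g (enum_val l).1).
exists #|{: 'I_m * 'I_r.+1}|, h; split.
  move=> l; have [[gH gd] gD] := gP (enum_val l).1; split; last exact: hom_down_gHom.
  split; first exact: hom_down_gHom.
  move=> y; have [dL dE] := linear_pack (res_d_morphism R i).1.
  rewrite dE linear_sum big1 // => j _.
  by have /ffunP/(_ j) := gd (mx_trunc Z j (enum_val l).2 y); rewrite !ffunE -dE.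
move=> f [fH fd] fD.
have [||a aP] := gen (hom_up f).
- split; first exact: hom_up_gHom.
  by move=> x; apply/ffunP => j; rewrite !ffunE fd.
- exact: hom_up_gHom.
exists (fun l => X (a (enum_val l).1) ord0 (enum_val l).2).
(* The errors left for [hom_up f] and for f. As [hom_down ord0] takes the first to the second, it
   remains to see that it preserves coboundaries. *)
set c := fun x => _ in aP; set c' := fun x => _.
have cE y : c' y = hom_down ord0 c y.
  rewrite [RHS]hom_downB [in RHS]hom_downK; last exact: in_gHom_zmod fH.
  congr (_ - _); rewrite hom_down_sum.
  rewrite [LHS](_ : _ = \sum_(t : 'I_m * 'I_r.+1)
    hom_down t.2 (g t.1) (trunc_rmul y (X (a t.1) ord0 t.2))); last first.
    by rewrite [RHS]big_enum_val.
  rewrite -(pair_bigA _ (fun l p => hom_down p (g l) (trunc_rmul y (X (a l) ord0 p)))).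
  apply: eq_bigr => l _; rewrite -hom_down_rmul //.
  by have [[/in_gHom_zmod]] := gP l.
clearbody c c'; clear -aP cE.
case: i c c' aP cE => [|i] c c' /=.
  by move=> c0 cE y; rewrite cE /hom_down big1 // => j _; rewrite c0 ffunE.
move=> [u [uH uE]] cE; exists (hom_down ord0 u); split; first exact: hom_down_gHom.
move=> y; rewrite cE; have [dL dE] := linear_pack (res_d_morphism R i).1.
rewrite dE linear_sum; apply: eq_bigr => j _.
by rewrite uE ffunE dE.
Qed.

End ExtTransfer.

(** * Finite generation of Hom_B(S, N) and property chi *)

Section ChiTransfer.
Variables (k : fieldType) (A B : algType k) (gA : grading A) (gB : grading B).
Variables (r : nat) (X : graded_mx_morphism gA gB r) (Z : graded_mx_morphism gB gA r).
Hypothesis XZ : forall b j p, \sum_l X (Z b l j) l p = if j == p then b else 0.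
Hypothesis ZX : forall a l j, \sum_p Z (X a j p) l p = if l == j then a else 0.
(** The coordinate forms u_i of the basis (t_i) satisfy (a u_i)(t_j) = u_i(t_j a) = X(a)_ji, so this
    says that they generate Hom_B(S, B) over A. *)
Hypothesis Xfg : forall w : 'I_r.+1 -> B, exists a : 'I_r.+1 -> A,
  forall j, w j = \sum_i X (a i) j i.

(** The generators are s |-> u_q(s) g_l, for u_q the coordinate form at t_q. Writing each v(t_j) as
    a combination of the g_l reduces to [Xfg], applied to the coefficients of one g_l at a time. *)
Lemma mxres_finitely_generated (N : gmod gB) :
  finitely_generated N -> finitely_generated (gmxres X N).
Proof.
move=> [m [g gP]].
pose e (l : 'I_#|{: 'I_m * 'I_r.+1}|) : gmxres X N :=
  [ffun j => if j == (enum_val l).2 then g (enum_val l).1 else 0] : mxres X N.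
exists #|{: 'I_m * 'I_r.+1}|, e => v.
have /choice[c cP] := fun j => gP ((v : mxres X N) j).
have /choice[a aP] := fun l => Xfg (fun j => c j l).
exists (fun l => a (enum_val l).1 (enum_val l).2).
apply/ffunP => j; rewrite cP sum_ffunE.
rewrite [RHS](_ : _ = \sum_(t : 'I_m * 'I_r.+1) X (a t.1 t.2) j t.2 *: g t.1).
  rewrite -(pair_bigA _ (fun l q => X (a l q) j q *: g l)) /=.
  by apply: eq_bigr => l _; rewrite aP scaler_suml.
rewrite [RHS]big_enum_val; apply: eq_bigr => l _.
rewrite mxresZ (bigD1 (enum_val l).2) //= ffunE eqxx big1 ?addr0 // => q ql.
by rewrite ffunE (negbTE ql) scaler0.
Qed.

Lemma chi_transfer : property_chi gA -> property_chi gB.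
Proof.
move=> chiA i d N /mxres_finitely_generated fgN.
have [n0 n0P] := chiA i d _ fgN.
by exists n0 => n nn R; apply: (ext_transfer (XZ := XZ) (ZX := ZX)); exact: n0P.
Qed.

End ChiTransfer.

(** * Matrix morphisms from two bases of a common overring *)

Section CommonOverring.
Variables (k : fieldType) (A B : algType k) (gA : grading A) (gB : grading B).
Variables (S : nzRingType) (iA : {rmorphism A -> S}) (iB : {rmorphism B -> S}).
Variables (r : nat) (t : 'I_r.+1 -> S) (hS : nat -> {additive S -> S}).
Hypothesis spanB : forall s, exists b : 'I_r.+1 -> B, s = \sum_l iB (b l) * t l.
Hypothesis freeB : forall b : 'I_r.+1 -> B,
  \sum_l iB (b l) * t l = 0 -> forall l, b l = 0.
Hypothesis spanA : forall s, exists a : 'I_r.+1 -> A, s = \sum_l t l * iA (a l).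
Hypothesis freeA : forall a : 'I_r.+1 -> A,
  \sum_l t l * iA (a l) = 0 -> forall l, a l = 0.
(** [hS i] is the projection of S onto degree i, the t_l having degree 0. *)
Hypothesis hSB : forall i b l, hS i (iB b * t l) = iB (hcomp gB i b) * t l.
Hypothesis hSA : forall i a l, hS i (t l * iA a) = t l * iA (hcomp gA i a).

Let injB (b b' : 'I_r.+1 -> B) :
  \sum_l iB (b l) * t l = \sum_l iB (b' l) * t l -> b =1 b'.
Proof.
move=> e l; apply/eqP; rewrite -subr_eq0; apply/eqP.
apply: (freeB (b := fun l => b l - b' l)).
under eq_bigr do rewrite rmorphB mulrBl.
by rewrite sumrB e subrr.
Qed.

Let injA (a a' : 'I_r.+1 -> A) :
  \sum_l t l * iA (a l) = \sum_l t l * iA (a' l) -> a =1 a'.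
Proof.
move=> e l; apply/eqP; rewrite -subr_eq0; apply/eqP.
apply: (freeA (a := fun l => a l - a' l)).
under eq_bigr do rewrite rmorphB mulrBr.
by rewrite sumrB e subrr.
Qed.

(** Every property of X is checked by comparing coefficients: multiplicativity comes from t_j (a a')
    = (t_j a) a', gradedness from applying [hS i] to t_j a. *)
Let mxX : exists X : graded_mx_morphism gA gB r,
  forall a j, t j * iA a = \sum_l iB (X a j l) * t l.
Proof.
have /choice[c cP] := spanB.
pose X a : 'M[B]_r.+1 := \matrix_(j, l) c (t j * iA a) l.
have XP a j : t j * iA a = \sum_l iB (X a j l) * t l.
  by rewrite [LHS]cP; apply: eq_bigr => l _; rewrite mxE.
have Xzmod : zmod_morphism X.
  move=> a a'; apply/matrixP => j; apply: injB; rewrite -XP rmorphB mulrBr !XP -sumrB.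
  by apply: eq_bigr => l _; rewrite !mxE rmorphB mulrBl.
have Xmon : monoid_morphism X.
  split.
    apply/matrixP => j; apply: injB; rewrite -XP rmorph1 mulr1 (bigD1 j) //=.
    rewrite mxE eqxx rmorph1 mul1r big1 ?addr0 // => l lj.
    by rewrite mxE eq_sym (negbTE lj) rmorph0 mul0r.
  move=> a a'; apply/matrixP => j; apply: injB; rewrite -XP rmorphM mulrA XP.
  rewrite mulr_suml; under eq_bigr do rewrite -mulrA XP mulr_sumr.
  rewrite exchange_big; apply: eq_bigr => l _ /=; rewrite [in RHS]mxE rmorph_sum mulr_suml.
  by apply: eq_bigr => q _; rewrite rmorphM mulrA.
pose XM : {rmorphism A -> 'M[B]_r.+1} := HB.pack_for {rmorphism A -> 'M[B]_r.+1} X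
  (GRing.isZmodMorphism.Build _ _ X Xzmod) (GRing.isMonoidMorphism.Build _ _ X Xmon).
have XMh i a : XM (hcomp gA i a) = map_mx (hcomp gB i) (XM a).
  apply/matrixP => j; apply: injB; rewrite -XP -hSA XP raddf_sum.
  by apply: eq_bigr => l _; rewrite [in RHS]mxE hSB.
by exists (GradedMxMorphism XMh).
Qed.

Let mxZ : exists Z : graded_mx_morphism gB gA r,
  forall b j, iB b * t j = \sum_l t l * iA (Z b l j).
Proof.
have /choice[c cP] := spanA.
pose Z b : 'M[A]_r.+1 := \matrix_(l, j) c (iB b * t j) l.
have ZP b j : iB b * t j = \sum_l t l * iA (Z b l j).
  by rewrite [LHS]cP; apply: eq_bigr => l _; rewrite mxE.
have Zzmod : zmod_morphism Z.
  move=> b b'; apply/matrixP => l j; move: l; apply: injA.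
  rewrite -ZP rmorphB mulrBl !ZP -sumrB.
  by apply: eq_bigr => l _; rewrite !mxE rmorphB mulrBr.
have Zmon : monoid_morphism Z.
  split.
    apply/matrixP => l j; move: l; apply: injA.
    rewrite -ZP rmorph1 mul1r (bigD1 j) //=.
    rewrite mxE eqxx rmorph1 mulr1 big1 ?addr0 // => l lj.
    by rewrite mxE (negbTE lj) rmorph0 mulr0.
  move=> b b'; apply/matrixP => l j; move: l; apply: injA.
  rewrite -ZP rmorphM -mulrA ZP.
  rewrite mulr_sumr; under eq_bigr do rewrite mulrA ZP mulr_suml.
  rewrite exchange_big; apply: eq_bigr => l _ /=; rewrite [in RHS]mxE rmorph_sum mulr_sumr.
  by apply: eq_bigr => q _; rewrite rmorphM mulrA.
pose ZM : {rmorphism B -> 'M[A]_r.+1} := HB.pack_for {rmorphism B -> 'M[A]_r.+1} Z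
  (GRing.isZmodMorphism.Build _ _ Z Zzmod) (GRing.isMonoidMorphism.Build _ _ Z Zmon).
have ZMh i b : ZM (hcomp gB i b) = map_mx (hcomp gA i) (ZM b).
  apply/matrixP => l j; move: l; apply: injA; rewrite -ZP -hSB ZP raddf_sum.
  by apply: eq_bigr => l _; rewrite [in RHS]mxE hSA.
by exists (GradedMxMorphism ZMh).
Qed.

(** The premise is [Xfg] stated without X: c_ii is X(a_i)_ji, and the map to reach has value b at
    t_q and 0 at the other t_j. General maps are sums of these over q. *)
Lemma chi_common_overring :
  (forall (b : B) (q : 'I_r.+1), exists a : 'I_r.+1 -> A, forall j,
     exists c : 'I_r.+1 -> 'I_r.+1 -> B,
       (forall i, t j * iA (a i) = \sum_l iB (c i l) * t l) /\
       \sum_i c i i = if j == q then b else 0) ->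
  property_chi gA -> property_chi gB.
Proof.
move=> fg; have [X XP] := mxX; have [Z ZP] := mxZ.
apply: (chi_transfer (X := X) (Z := Z)).
- move=> b j; apply: injB.
  transitivity (iB b * t j).
    rewrite ZP; under [RHS]eq_bigr do rewrite XP.
    rewrite exchange_big; apply: eq_bigr => l _.
    by rewrite rmorph_sum mulr_suml.
  rewrite (bigD1 j) //= eqxx big1 ?addr0 // => l lj.
  by rewrite eq_sym (negbTE lj) rmorph0 mul0r.
- move=> a l j; move: l; apply: injA.
  transitivity (t j * iA a).
    rewrite XP; under [RHS]eq_bigr do rewrite ZP.
    rewrite exchange_big; apply: eq_bigr => l _.
    by rewrite rmorph_sum mulr_sumr.
  rewrite (bigD1 j) //= eqxx big1 ?addr0 // => l lj.
  by rewrite (negbTE lj) rmorph0 mulr0.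
- move=> w; have /choice[a aP] := fun q => fg (w q) q.
  exists (fun i => \sum_q a q i) => j.
  under eq_bigr do rewrite rmorph_sum summxE.
  rewrite exchange_big (bigD1 j) //= [X in _ + X]big1 => [|q qj]; last first.
    have [c [cP cE]] := aP q j; rewrite eq_sym (negbTE qj) in cE; rewrite -[RHS]cE.
    by apply: eq_bigr => i _; apply: (injB (b' := c i)); rewrite -cP XP.
  have [c [cP cE]] := aP j j; rewrite eqxx in cE; rewrite addr0 -[LHS]cE.
  by apply: eq_bigr => i _; apply: (injB (b := c i)); rewrite -cP XP.
Qed.

End CommonOverring.

(** * Linear maps on tensor products and dual bases *)

Lemma tens_lift_exists (k : fieldType) (U V W : lmodType k) (F : U -> V -> W) :
  bilinear_for *:%R *:%R F ->
  exists f : {linear U ⊗ V -> W}, forall u v, f (u *t v) = F u v.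
Proof.
move=> Fb; pose FB := HB.pack_for {bilinear U -> V -> W} F
  (bilinear_isBilinear.Build k U V W *:%R *:%R F Fb).
by exists (tens_lift FB) => u v; exact: tens_lift_pure.
Qed.

(** A basis of E is transported along phi; the nonzero v excludes the empty basis, so the size has
    the form [r.+1]. *)
Lemma exists_dual_basis (k : fieldType) (E : vectType k) (V : lmodType k)
    (phi : {linear V -> E}) (v : V) : bijective phi -> v != 0 ->
  exists r (e : 'I_r.+1 -> V) (lam : 'I_r.+1 -> {linear V -> k^o}),
    (forall i j, lam i (e j) = (i == j)%:R) /\
    forall x, x = \sum_i (lam i x : k) *: e i.
Proof.
move=> [psi phiK psiK] v0.
have [psiL psiE] := linear_pack (can2_linear phiK psiK).
rewrite psiE in phiK psiK.
have dim0 : \dim (@fullv k E) != 0%N.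
  rewrite dimv_eq0; apply/eqP => E0; have := memvf (phi v).
  by rewrite E0 memv0 => /eqP pv; move: v0; rewrite -(phiK v) pv linear0 eqxx.
have := vbasisP (@fullv k E).
case: (\dim _) (vbasis _) dim0 => // r X _ bX.
exists r, (fun i => psiL X`_i), (fun i => (coord X i \o phi : {linear V -> k^o})).
split=> [i j|x] /=; first by rewrite psiK (coord_free _ _ (basis_free bX)) eq_sym.
rewrite -[LHS](phiK x) [in LHS](coord_basis bX (memvf (phi x))) linear_sum.
by apply: eq_bigr => i _; rewrite linearZ.
Qed.

Section Slice.
Variables (k : fieldType) (U V : lmodType k) (f : {linear V -> k^o}).

Definition slice_pure (u : U) (v : V) : U := (f v : k) *: u.
Fact slice_bilin : bilinear_for *:%R *:%R slice_pure.
Proof.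
split=> [v c u u' | u c v v']; rewrite /slice_pure /=.
  by rewrite scalerDr !scalerA mulrC.
by rewrite linearP scalerDl scalerA.
Qed.
HB.instance Definition _ :=
  bilinear_isBilinear.Build k U V U *:%R *:%R slice_pure slice_bilin.

(** This is id ⊗ f, with U ⊗ k identified with U; [coslice] is its mirror image. *)
Definition slice : U ⊗ V -> U := tens_lift slice_pure.
HB.instance Definition _ := GRing.Linear.on slice.

Lemma sliceE u v : slice (u *t v) = (f v : k) *: u.
Proof. exact: tens_lift_pure. Qed.
End Slice.


Section Coslice.
Variables (k : fieldType) (U V : lmodType k) (f : {linear U -> k^o}).

Definition coslice_pure (u : U) (v : V) : V := (f u : k) *: v.
Fact coslice_bilin : bilinear_for *:%R *:%R coslice_pure.
Proof.
split=> [v c u u' | u c v v']; rewrite /coslice_pure /=.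
  by rewrite linearP [X in X *: v = _]/(_ + _ : k) scalerDl scalerA.
by rewrite scalerDr !scalerA mulrC.
Qed.
HB.instance Definition _ :=
  bilinear_isBilinear.Build k U V V *:%R *:%R coslice_pure coslice_bilin.

Definition coslice : U ⊗ V -> V := tens_lift coslice_pure.
HB.instance Definition _ := GRing.Linear.on coslice.

Lemma cosliceE u v : coslice (u *t v) = (f u : k) *: v.
Proof. exact: tens_lift_pure. Qed.
End Coslice.

Section Insertion.
Variables (k : fieldType) (T : algType k).

Definition insert_pure (g p q : T) : T := p * g * q.
Fact insert_bilin g : bilinear_for *:%R *:%R (insert_pure g).
Proof.
split=> [q c p p' | p c q q']; rewrite /insert_pure /=.
  by rewrite !mulrDl -!scalerAl.
by rewrite mulrDr -scalerAr.
Qed.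
HB.instance Definition _ g :=
  bilinear_isBilinear.Build k T T T *:%R *:%R (insert_pure g) (insert_bilin g).

Definition insert (g : T) : T ⊗ T -> T := tens_lift (insert_pure g).
HB.instance Definition _ g := GRing.Linear.on (insert g).

Lemma insertE g p q : insert g (p *t q) = p * g * q.
Proof. exact: tens_lift_pure. Qed.

Lemma insertP c g g' x : insert (c *: g + g') x = c *: insert g x + insert g' x.
Proof.
elim/tens_ind: x => [|p q x ih]; first by rewrite !linear0 ?scaler0 addr0.
rewrite !linearD /= ih !insertE addrACA; congr (_ + _).
by rewrite mulrDr mulrDl -scalerAr -scalerAl.
Qed.

Lemma insert_mulr g x q : insert g (x * (1 *t q)) = insert g x * q.
Proof.
elim/tens_ind: x => [|u v x ih]; first by rewrite mul0r linear0 mul0r.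
rewrite mulrDl !linearD /= ih mulrDl; congr (_ + _).
by rewrite tpureM mulr1 !insertE mulrA.
Qed.

Lemma insert_mull g p x : insert g ((p *t 1) * x) = p * insert g x.
Proof.
elim/tens_ind: x => [|u v x ih]; first by rewrite mulr0 linear0 mulr0.
rewrite mulrDr !linearD /= ih mulrDr; congr (_ + _).
by rewrite tpureM mul1r !insertE !mulrA.
Qed.
End Insertion.

(** * The Galois map as a map of T-bimodules *)

Section GaloisMap.
Variables (k : fieldType) (H T : algType k) (rho : {lrmorphism T -> H ⊗ T}).

Definition galois_map (x : T ⊗ T) : H ⊗ T :=
  tens_map idfun (@mul_map k T) (tens_assoc (tens_map rho idfun x)).
Fact galois_map_linear : linear galois_map.
Proof. by move=> c x y; rewrite /galois_map !linearP. Qed.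
HB.instance Definition _ :=
  GRing.isLinear.Build k (T ⊗ T) (H ⊗ T) *:%R galois_map galois_map_linear.

Lemma galois_mapE p q : galois_map (p *t q) = rho p * (1 *t q).
Proof.
rewrite /galois_map (_ : tens_map rho idfun (p *t q) = rho p *t q) ?tens_mapE //.
elim/tens_ind: (rho p) => [|h t x ih].
  by rewrite linear0l !linear0 mul0r.
rewrite linearDl !linearD /= ih mulrDl; congr (_ + _).
by rewrite tens_assocE tens_mapE tpureM mulr1; congr (_ *t _); exact: tens_lift_pure.
Qed.

Lemma galois_map_mulr x q : galois_map (x * (1 *t q)) = galois_map x * (1 *t q).
Proof.
elim/tens_ind: x => [|u v x ih]; first by rewrite mul0r linear0 mul0r.
rewrite mulrDl !linearD /= ih mulrDl; congr (_ + _).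
by rewrite tpureM mulr1 !galois_mapE -mulrA tpureM mulr1.
Qed.

Lemma galois_map_mull p x : galois_map ((p *t 1) * x) = rho p * galois_map x.
Proof.
elim/tens_ind: x => [|u v x ih]; first by rewrite mulr0 linear0 mulr0.
rewrite mulrDr !linearD /= ih mulrDr; congr (_ + _).
by rewrite tpureM mul1r !galois_mapE rmorphM mulrA.
Qed.

Lemma galois_map_inverse :
  bijective galois_map -> exists kap : {linear H ⊗ T -> T ⊗ T},
    cancel galois_map kap /\ cancel kap galois_map.
Proof.
move=> [kap canK kapK].
have [kapL kapE] := linear_pack (can2_linear canK kapK).
by exists kapL; rewrite -kapE.
Qed.
End GaloisMap.

(** * The inverse Galois map and the Miyashita-Ulbrich action *)

Section Torsor.
Variables (k : fieldType) (H : algType k) (hH : hopf_algebra H).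
Variables (T : algType k) (rho : {lrmorphism T -> H ⊗ T}).
Hypothesis comodT : left_comodule_algebra hH rho.
Variable kap : {linear H ⊗ T -> T ⊗ T}.
Hypotheses (canK : cancel (galois_map rho) kap) (kapK : cancel kap (galois_map rho)).

Lemma translation_mulr x q : kap (x * (1 *t q)) = kap x * (1 *t q).
Proof. by apply: (can_inj canK); rewrite kapK galois_map_mulr kapK. Qed.

(** After substituting x = p_(-1) ⊗ p_0 q this is coassociativity of [rho]: both sides come from
    p_(-2) ⊗ p_(-1) ⊗ p_0 q. *)
Lemma translation_colinear x :
  tens_map idfun kap (tens_assoc (tens_map (comul hH) idfun x)) =
  tens_assoc (tens_map rho idfun (kap x)).
Proof.
rewrite -{1}(kapK x); move: (kap x) => {x}; elim/tens_ind=> [|p q x ih].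
  by rewrite !linear0.
rewrite !linearD /= ih; congr (_ + _).
have -> : tens_map rho idfun (p *t q) = rho p *t q by exact: tens_mapE.
have -> : tens_assoc (rho p *t q) =
    tens_map idfun kap (tens_map idfun rho (rho p) * (1 *t (1 *t q))).
  elim/tens_ind: (rho p) => [|h t y ihy]; first by rewrite linear0l !linear0 mul0r linear0.
  rewrite linearDl !linearD /= mulrDl linearD ihy; congr (_ + _).
  have -> : tens_map idfun rho (h *t t) = h *t rho t by exact: tens_mapE.
  rewrite tens_assocE tpureM mulr1 [RHS]tens_mapE /=; congr (_ *t _).
  by rewrite -galois_mapE canK.
congr (tens_map _ _ _); rewrite galois_mapE -(lcoact_coassoc comodT).
rewrite !rmorphM /=; congr (_ * _).
rewrite tens_mapE rmorph1 -[1 in LHS]tpure1.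
exact: tens_assocE.
Qed.

Lemma coslice_counit u : coslice (counit hH) (rho u) = u.
Proof.
have e x : coslice (counit hH) x = coslice idfun (tens_map (counit hH) idfun x) :> T.
  elim/tens_ind: x => [|h t x ih]; first by rewrite !linear0.
  by rewrite !linearD /= ih tens_mapE !cosliceE.
by rewrite e (lcoact_counit comodT) cosliceE /= scale1r.
Qed.

(** For x = p_(-1) ⊗ p_0 q both sides are p q, by the counit axiom. In particular h' h'' = eps(h) 1,
    where eps is the counit. *)
Lemma mul_translation x : @mul_map k T (kap x) = coslice (counit hH) x.
Proof.
rewrite -{2}(kapK x); elim/tens_ind: (kap x) => [|p q y ih]; first by rewrite !linear0.
rewrite !linearD /= ih; congr (_ + _); rewrite galois_mapE.
rewrite [LHS]tens_lift_pure -[in LHS](coslice_counit p).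
elim/tens_ind: (rho p) => [|h t z ihz]; first by rewrite !linear0 mul0r linear0 [LHS]mul0r.
rewrite mulrDl !linearD /= -ihz [LHS]mulrDl; congr (_ + _).
by rewrite tpureM mulr1 !cosliceE; exact/esym/scalerAl.
Qed.

(* The Miyashita-Ulbrich action: h acts by [g |-> h' g h''], where [kap (h ⊗ 1)] is
   the sum of the [h' ⊗ h'']. *)
Definition mu_act (h : H) (g : T) : T := insert g (kap (h *t 1)).

Fact mu_act_bilin : bilinear_for *:%R *:%R mu_act.
Proof.
split=> [g c h h' | h c g g']; rewrite /mu_act /=; last exact: insertP.
by rewrite linearPl !linearP.
Qed.
HB.instance Definition _ :=
  bilinear_isBilinear.Build k H T T *:%R *:%R mu_act mu_act_bilin.

Lemma mu_act1 g : mu_act 1 g = g.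
Proof.
have -> : mu_act 1 g = insert g (kap (galois_map rho (1 *t 1))).
  by rewrite galois_mapE rmorph1 mul1r.
by rewrite canK insertE mul1r mulr1.
Qed.

(* In the proof, sw is right multiplication by [kap (h' ⊗ 1)] in T ⊗ T^op. *)
Lemma mu_actM h h' g : mu_act (h * h') g = mu_act h (mu_act h' g).
Proof.
have [sw swE] : exists sw : {linear T ⊗ T -> T ⊗ T}, forall p q,
    sw (p *t q) = (p *t 1) * kap (h' *t 1) * (1 *t q).
  apply: tens_lift_exists; split=> [q c p p' | p c q q'] /=.
    by rewrite linearPl !mulrDl -!scalerAl.
  by rewrite linearPr mulrDr -scalerAr.
have sw_can z : galois_map rho (sw z) = galois_map rho z * (h' *t 1).
  elim/tens_ind: z => [|p q z ih]; first by rewrite !linear0 mul0r.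
  rewrite !linearD /= ih mulrDl; congr (_ + _).
  rewrite swE galois_map_mulr galois_map_mull kapK galois_mapE -!mulrA.
  by rewrite !tpureM !mul1r !mulr1.
have sw_ins z : insert g (sw z) = insert (insert g (kap (h' *t 1))) z.
  elim/tens_ind: z => [|p q z ih]; first by rewrite !linear0.
  by rewrite !linearD /= ih swE insert_mulr insert_mull !insertE.
rewrite /mu_act -sw_ins; congr (insert g _); apply: (can_inj canK).
by rewrite sw_can !kapK tpureM mulr1.
Qed.

(** With nu u = S(u_(-1)) . u_0, S the antipode, one has u_(-1) . nu(u_0) = (u_(-2) S(u_(-1))) . u_0
    = eps(u_(-1)) u_0 = u. *)
Lemma mu_act_section : exists nu : {linear T -> T},
  forall u, tens_lift mu_act (tens_map idfun nu (rho u)) = u.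
Proof.
(* nu u = S(u_(-1)) . u_0 *)
exists (tens_lift mu_act \o tens_map (antipode hH) idfun \o rho) => u.
(* [om] is h1 ⊗ h2 ⊗ t |-> h1 . (S(h2) . t); it isolates the iterated coaction, to which
   coassociativity applies. *)
have [om omE] : exists om : {linear H ⊗ (H ⊗ T) -> T}, forall z, om z =
    tens_lift mu_act (tens_map idfun
      (tens_lift mu_act \o tens_map (antipode hH) idfun) z).
  by exists (tens_lift mu_act \o
    tens_map idfun (tens_lift mu_act \o tens_map (antipode hH) idfun)).
have -> z : tens_lift mu_act (tens_map idfun
    (tens_lift mu_act \o tens_map (antipode hH) idfun \o rho) z) =
    om (tens_map idfun rho z).
  elim/tens_ind: z => [|h t z ih]; first by rewrite !linear0.
  by rewrite !linearD /= ih !omE !tens_mapE.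
rewrite -(lcoact_coassoc comodT) -[RHS]coslice_counit.
elim/tens_ind: (rho u) => [|h t z ih]; first by rewrite !linear0.
rewrite !linearD /= ih; congr (_ + _).
rewrite tens_mapE cosliceE.
have -> d : om (tens_assoc (d *t idfun t)) =
    mu_act (mul_map (tens_map idfun (antipode hH) d)) t.
  elim/tens_ind: d => [|h1 h2 d ihd].
    by rewrite linear0l !linear0 /= linear0l.
  rewrite linearDl !linearD /= ihd linearDl; congr (_ + _).
  rewrite tens_assocE omE /= !tens_mapE !tens_lift_pure /= tens_mapE tens_lift_pure.
  have -> : mul_map (h1 *t antipode hH h2) = h1 * antipode hH h2 by exact: tens_lift_pure.
  by rewrite mu_actM.
by rewrite antipode_right linearZl_LR /= mu_act1.
Qed.

End Torsor.

(** * The overring A ⊗ T of the cotensor algebra *)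

Section CotensorOverring.
Variables (k : fieldType) (H : algType k) (hH : hopf_algebra H).
Variables (T : algType k) (rhoT : {lrmorphism T -> H ⊗ T}).
Hypothesis comodT : left_comodule_algebra hH rhoT.
Variable kap : {linear H ⊗ T -> T ⊗ T}.
Hypotheses (canK : cancel (galois_map rhoT) kap) (kapK : cancel kap (galois_map rhoT)).
Variables (A : algType k) (rhoA : {lrmorphism A -> A ⊗ H}).
Hypothesis comodA : right_comodule_algebra hH rhoA.

Definition coact_left (x : A ⊗ T) : A ⊗ (H ⊗ T) :=
  tens_assoc (tens_map rhoA idfun x).
Fact coact_left_linear : linear coact_left.
Proof. by move=> c x y; rewrite /coact_left !linearP. Qed.
HB.instance Definition _ := GRing.isLinear.Build k (A ⊗ T) (A ⊗ (H ⊗ T)) *:%R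
  coact_left coact_left_linear.
Fact coact_left_monoid : monoid_morphism coact_left.
Proof. by split=> [|x y]; rewrite /coact_left ?rmorph1 // !rmorphM. Qed.
HB.instance Definition _ := GRing.isMonoidMorphism.Build (A ⊗ T) (A ⊗ (H ⊗ T))
  coact_left coact_left_monoid.

Lemma coact_leftE a t : coact_left (a *t t) = tens_assoc (rhoA a *t t).
Proof. by congr (tens_assoc _); exact: tens_mapE. Qed.

(* The inverse of the isomorphism B ⊗ T -> A ⊗ T, x ⊗ t |-> x (1 ⊗ t). *)
Definition untwist (x : A ⊗ T) : A ⊗ (T ⊗ T) := tens_map idfun kap (coact_left x).
Fact untwist_linear : linear untwist.
Proof. by move=> c x y; rewrite /untwist !linearP. Qed.
HB.instance Definition _ := GRing.isLinear.Build k (A ⊗ T) (A ⊗ (T ⊗ T)) *:%R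
  untwist untwist_linear.

(** On the cotensor algebra the coaction of A can be replaced by that of T, and a ⊗ u_(-1) ⊗ u_0 t
    is the Galois map applied to u ⊗ t, which [kap] undoes. *)
Lemma untwist_cotensor x t : x \in cotensor_pred rhoA rhoT ->
  untwist (x * (1 *t t)) = tens_assoc (x *t t).
Proof.
rewrite unfold_in => /eqP; rewrite -/(coact_left x) => xP.
rewrite /untwist rmorphM /= xP coact_leftE rmorph1.
have -> : tens_assoc (1 *t t) = 1 *t (1 *t t) :> A ⊗ (H ⊗ T).
  by rewrite -tpure1 tens_assocE.
elim/tens_ind: x {xP} => [|a u x ih]; first by rewrite linear0l !linear0 mul0r linear0.
rewrite linearDl !linearD /= mulrDl linearD /= ih; congr (_ + _).
have -> : tens_map idfun rhoT (a *t u) = a *t rhoT u by exact: tens_mapE.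
by rewrite tpureM mulr1 tens_mapE -galois_mapE canK tens_assocE.
Qed.

Lemma insert_assoc g x t :
  tens_map idfun (insert g) (tens_assoc (x *t t)) = x * (1 *t (g * t)) :> A ⊗ T.
Proof.
elim/tens_ind: x => [|a u x ih]; first by rewrite linear0l !linear0 mul0r.
rewrite linearDl !linearD /= mulrDl ih; congr (_ + _).
by rewrite tens_assocE tens_mapE /= tpureM mulr1 insertE mulrA.
Qed.

(** Both sides are a_0 ⊗ (a_1 . nu t) w, because [kap] is right T-linear. *)
Lemma insert_untwist (nu : {linear T -> T}) a t w :
  tens_map idfun (insert (nu t)) (untwist (a *t w)) =
  tens_map idfun (tens_lift (mu_act kap))
    (tens_map idfun (tens_map idfun nu) (coact_left (a *t t))) * (1 *t w).
Proof.
rewrite /untwist !coact_leftE; elim/tens_ind: (rhoA a) => [|b h x ih].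
  by rewrite !linear0l !linear0 mul0r.
rewrite !linearDl !linearD /= mulrDl ih; congr (_ + _).
rewrite !tens_assocE !tens_mapE /= !tens_mapE tens_lift_pure tpureM mulr1.
congr (_ *t _); rewrite /mu_act -insert_mulr -(translation_mulr canK kapK).
by rewrite tpureM mulr1 mul1r.
Qed.

(** Summing [insert_untwist] gives the a_i0 ⊗ (a_i1 . nu t_i) w; the cotensor condition turns a_i1 .
    nu t_i into t_i(-1) . nu(t_i0) = t_i. *)
Lemma insert_untwist_cotensor (nu : {linear T -> T}) (I : finType) (a : I -> A)
    (t : I -> T) w :
  (forall u, tens_lift (mu_act kap) (tens_map idfun nu (rhoT u)) = u) ->
  \sum_i a i *t t i \in cotensor_pred rhoA rhoT ->
  \sum_i tens_map idfun (insert (nu (t i))) (untwist (a i *t w)) =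
  (\sum_i a i *t t i) * (1 *t w).
Proof.
move=> nuP; rewrite unfold_in => /eqP; rewrite -/(coact_left _) => xP.
under eq_bigr do rewrite insert_untwist.
rewrite -mulr_suml -!linear_sum /=; congr (_ * _); rewrite xP.
elim/tens_ind: (\sum_i _) => [|b u x ih]; first by rewrite !linear0.
rewrite !linearD /= ih; congr (_ + _).
have -> : tens_map idfun rhoT (b *t u) = b *t rhoT u by exact: tens_mapE.
by rewrite !tens_mapE /= nuP.
Qed.

Lemma slice_counit a : slice (counit hH) (rhoA a) = a.
Proof.
have e z : slice (counit hH) z = slice idfun (tens_map idfun (counit hH) z) :> A.
  elim/tens_ind: z => [|b h z ihz]; first by rewrite !linear0.
  by rewrite !linearD /= ihz tens_mapE !sliceE.
by rewrite e (rcoact_counit comodA) sliceE /= scale1r.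
Qed.

(** The element a_0 ⊗ a_1' a_1'' t is a_0 eps(a_1) ⊗ t = a ⊗ t. *)
Lemma mul_untwist x : tens_map idfun (@mul_map k T) (untwist x) = x.
Proof.
elim/tens_ind: x => [|a t x ih]; first by rewrite !linear0.
rewrite !linearD /= ih; congr (_ + _); rewrite /untwist coact_leftE.
rewrite -[in RHS](slice_counit a).
elim/tens_ind: (rhoA a) => [|b h z ihz].
  by rewrite !linear0l !linear0 linear0l.
rewrite linearDl !linearD /= ihz linearDl; congr (_ + _).
rewrite tens_assocE !tens_mapE /= (mul_translation comodT kapK) sliceE cosliceE.
by rewrite linearZr_LR linearZl_LR.
Qed.

(** So [untwist x] lies in B ⊗ T. Both coactions are moved past the slice and [kap] onto
    [coact_left x], where coassociativity of [rhoA] meets colinearity of [kap]. *)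
Lemma untwist_slice_cotensor (f : {linear T -> k^o}) x :
  tens_map idfun (slice f) (untwist x) \in cotensor_pred rhoA rhoT.
Proof.
have natA y : coact_left (tens_map idfun (slice f) y) =
    tens_map idfun (tens_map idfun (slice f)) (tens_assoc (tens_map rhoA idfun y)).
  elim/tens_ind: y => [|a z y ih]; first by rewrite !linear0.
  rewrite !linearD /= ih; congr (_ + _).
  have -> : tens_map rhoA idfun (a *t z) = rhoA a *t z by exact: tens_mapE.
  rewrite tens_mapE coact_leftE.
  elim/tens_ind: (rhoA a) => [|b h y' ihy]; first by rewrite !linear0l !linear0.
  by rewrite !linearDl !linearD /= ihy !tens_assocE !tens_mapE /= ?tens_mapE.
have natT y : tens_map idfun rhoT (tens_map idfun (slice f) y) =
    tens_map idfun (tens_map idfun (slice f))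
      (tens_map idfun (@tens_assoc k H T T \o tens_map rhoT idfun) y) :> A ⊗ (H ⊗ T).
  elim/tens_ind: y => [|a z y ih]; first by rewrite !linear0.
  rewrite !linearD /= ih; congr (_ + _); rewrite !tens_mapE /=.
  congr (_ *t _).
  elim/tens_ind: z => [|p q z ihz]; first by rewrite !linear0.
  rewrite !linearD /= ihz; congr (_ + _); rewrite sliceE linearZ /=.
  have -> : tens_map rhoT idfun (p *t q) = rhoT p *t q by exact: tens_mapE.
  elim/tens_ind: (rhoT p) => [|h t y' ihy]; first by rewrite linear0l !linear0 ?scaler0.
  rewrite !linearDl !linearD /= ihy; congr (_ + _).
  by rewrite tens_assocE tens_mapE /= sliceE linearZr_LR.
have nat_kap y : tens_assoc (tens_map rhoA idfun (tens_map idfun kap y)) =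
    tens_map idfun (tens_map idfun kap) (tens_assoc (tens_map rhoA idfun y)).
  elim/tens_ind: y => [|a z y ih]; first by rewrite !linear0.
  rewrite !linearD /= ih; congr (_ + _); rewrite tens_mapE /=.
  have -> : tens_map rhoA idfun (a *t z) = rhoA a *t z by exact: tens_mapE.
  have -> : tens_map rhoA idfun (a *t kap z) = rhoA a *t kap z by exact: tens_mapE.
  elim/tens_ind: (rhoA a) => [|b h y' ihy]; first by rewrite !linear0l !linear0.
  by rewrite !linearDl !linearD /= ihy !tens_assocE !tens_mapE /= ?tens_mapE.
have coass y : tens_assoc (tens_map rhoA idfun (coact_left y)) =
    tens_map idfun (@tens_assoc k H H T \o tens_map (comul hH) idfun) (coact_left y).
  elim/tens_ind: y => [|a t y ih]; first by rewrite !linear0.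
  rewrite !linearD /= ih; congr (_ + _); rewrite coact_leftE.
  (* [at'] appends the fixed t, so that coassociativity can be used in A ⊗ (H ⊗ H). *)
  have [at' atE] : exists at' : {linear A ⊗ (H ⊗ H) -> A ⊗ (H ⊗ (H ⊗ T))},
      forall b d, at' (b *t d) = b *t tens_assoc (d *t t).
    apply: tens_lift_exists; split=> [d c b b' | b c d d'] /=.
      by rewrite linearPl.
    by rewrite linearPl linearP linearPr.
  transitivity (at' (tens_assoc (tens_map rhoA idfun (rhoA a)))).
    elim/tens_ind: (rhoA a) => [|b h y' ihy]; first by rewrite !linear0l !linear0.
    rewrite !linearDl !linearD /= ihy; congr (_ + _).
    have -> : tens_map rhoA idfun (b *t h) = rhoA b *t h by exact: tens_mapE.
    rewrite tens_assocE.
    have -> : tens_map rhoA idfun (b *t (h *t t)) = rhoA b *t (h *t t) by exact: tens_mapE.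
    elim/tens_ind: (rhoA b) => [|b' h' z ihz]; first by rewrite !linear0l !linear0.
    by rewrite !linearDl !linearD /= ihz !tens_assocE atE tens_assocE.
  rewrite (rcoact_coassoc comodA).
  elim/tens_ind: (rhoA a) => [|b h y' ihy]; first by rewrite !linear0l !linear0.
  rewrite !linearDl !linearD /= ihy; congr (_ + _).
  rewrite tens_assocE [in RHS]tens_mapE.
  have -> : tens_map idfun (comul hH) (b *t h) = b *t comul hH h by exact: tens_mapE.
  rewrite atE /=; congr (_ *t tens_assoc _).
  by apply/esym; exact: tens_mapE.
rewrite unfold_in -/(coact_left _) natA natT nat_kap coass; apply/eqP; congr (tens_map _ _ _).
rewrite /untwist; elim/tens_ind: (coact_left x) => [|a z y ih]; first by rewrite !linear0.
rewrite !linearD /= ih; congr (_ + _); rewrite !tens_mapE /=.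
by rewrite (translation_colinear comodT canK kapK).
Qed.

End CotensorOverring.

(** * Coordinates along a dual basis *)

Section DualBasis.
Variables (k : fieldType) (r : nat) (V : lmodType k).
Variables (e : 'I_r -> V) (lam : 'I_r -> {linear V -> k^o}).
Hypothesis lam_e : forall i j, lam i (e j) = (i == j)%:R.
Hypothesis e_span : forall v, v = \sum_i (lam i v : k) *: e i.

Lemma tens_slice_sum (U : lmodType k) (x : U ⊗ V) :
  x = \sum_l slice (lam l) x *t e l.
Proof.
elim/tens_ind: x => [|u v x ih].
  by rewrite big1 // => l _; rewrite linear0 linear0l.
rewrite {1}ih; under [RHS]eq_bigr do rewrite linearD linearDl.
rewrite big_split /=; congr (_ + _).
rewrite {1}(e_span v) linear_sumr; apply: eq_bigr => l _.
by rewrite sliceE linearZr_LR linearZl_LR.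
Qed.

Lemma slice_dual (U : lmodType k) (u : U) i j :
  slice (lam i) (u *t e j) = if i == j then u else 0.
Proof. by rewrite sliceE lam_e; case: eqP => _; rewrite ?scale1r ?scale0r. Qed.

End DualBasis.

(** * Assembly for the overring A ⊗ T and a basis of T *)

Theorem theorem4p11 (k : fieldType)
    (H : falgType k) (hH : hopf_algebra H) (antipode_bij : bijective (antipode hH))
    (T : algType k) (rhoT : {lrmorphism T -> H ⊗ T}) (torsorT : left_torsor hH rhoT)
    (A : algType k) (gA : grading A) (rhoA : {lrmorphism A -> A ⊗ H})
    (comodA : connected_graded_comodule_algebra hH gA rhoA)
    (noethA : noetherian A) (gldimA : finite_global_dimension A) :
  property_chi gA ->
  property_chi (cotensor_grading rhoT (cgca_sub comodA)).
Proof.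
have comodT := torsor_comodule torsorT; have rcomodA := cgca_comodule comodA.
have [phi [phi_bij _]] := torsor_iso torsorT.
have [kap [canK kapK]] := galois_map_inverse (torsor_bij torsorT).
have [r [e [lam [lam_e e_span]]]] := exists_dual_basis phi_bij (oner_neq0 T).
have [nu nuP] := mu_act_section comodT canK kapK.
pose B := cotensor rhoA rhoT.
pose inA (a : A) : A ⊗ T := a *t 1.
have inA_zmod : zmod_morphism inA by move=> a b; exact: linearBl.
have inA_mon : monoid_morphism inA by split=> // a b; rewrite /inA tpureM mulr1.
pose iA := HB.pack_for {rmorphism A -> A ⊗ T} inA
  (GRing.isZmodMorphism.Build _ _ inA inA_zmod)
  (GRing.isMonoidMorphism.Build _ _ inA inA_mon).
pose iB : {rmorphism B -> A ⊗ T} := (val : B -> A ⊗ T).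
have spanB s : exists b : 'I_r.+1 -> B, s = \sum_l iB (b l) * (1 *t e l).
  (* Writing [untwist s] as a sum of b_l ⊗ e_l with b_l in B, and multiplying back, recovers s. *)
  exists (fun l => Cotensor
    (untwist_slice_cotensor comodT canK kapK rcomodA (lam l) s)) => /=.
  rewrite -[LHS](mul_untwist comodT kapK rcomodA).
  elim/tens_ind: (untwist kap rhoA s) => [|a z x ih].
    by rewrite !linear0 big1 // => l _; rewrite linear0 mul0r.
  under eq_bigr do rewrite linearD mulrDl.
  rewrite linearD /= ih big_split; congr (_ + _).
  under eq_bigr do rewrite tens_mapE tpureM mulr1.
  rewrite -linear_sumr tens_mapE; congr (_ *t _).
  rewrite {1}(tens_slice_sum e_span z) linear_sum; apply: eq_bigr => l _.
  exact: tens_lift_pure.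
have freeB (b : 'I_r.+1 -> B) : \sum_l iB (b l) * (1 *t e l) = 0 -> forall l, b l = 0.
  move=> b0 l; apply: val_inj; rewrite raddf0.
  have sl x q : tens_map idfun (slice (lam l)) (tens_assoc (x *t e q)) =
      if l == q then x else 0 :> A ⊗ T.
    elim/tens_ind: x => [|a u x ih]; first by rewrite !linear0l !linear0; case: eqP.
    rewrite linearDl !linearD /= ih tens_assocE tens_mapE /= slice_dual //.
    by case: eqP; rewrite ?linear0r ?addr0.
  (* F reads off the l-th coefficient, as [untwist] turns c (1 ⊗ e_q) into c ⊗ e_q. *)
  have [F FE] : exists F : {linear A ⊗ T -> A ⊗ T}, forall (c : B) q,
      F (iB c * (1 *t e q)) = if l == q then iB c else 0.
    exists (tens_map idfun (slice (lam l)) \o untwist kap rhoA) => c q /=.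
    by rewrite (untwist_cotensor canK) ?sl //; exact: (valP c).
  have := congr1 F b0; rewrite linear0 linear_sum => <-.
  under eq_bigr do rewrite FE.
  rewrite (bigD1 l) //= eqxx big1 ?addr0 // => i.
  by rewrite eq_sym => /negbTE ->.
have injB (b c : 'I_r.+1 -> B) : \sum_l iB (b l) * (1 *t e l) =
    \sum_l iB (c l) * (1 *t e l) -> b =1 c.
  move=> bc l; apply/eqP; rewrite -subr_eq0; apply/eqP.
  apply: (freeB (fun l => b l - c l)).
  by under eq_bigr do rewrite rmorphB mulrBl; rewrite sumrB bc subrr.
apply: (chi_common_overring (iA := iA) (iB := iB) (t := fun l => 1 *t e l)
  (hS := fun i => tens_map (hcomp gA i) (@idfun T)) spanB freeB).
- move=> s; exists (fun l => slice (lam l) s).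
  rewrite {1}(tens_slice_sum e_span s); apply: eq_bigr => l _.
  by rewrite /= /inA tpureM mul1r mulr1.
- move=> a a0 l; have := congr1 (slice (lam l)) a0.
  rewrite linear0 linear_sum /= => <-.
  under eq_bigr do rewrite /inA tpureM mul1r mulr1 (slice_dual lam_e).
  rewrite (bigD1 l) //= eqxx big1 ?addr0 // => i.
  by rewrite eq_sym => /negbTE ->.
- move=> i b l /=; elim/tens_ind: (cotensor_val b) => [|a u x ih].
    by rewrite mul0r linear0 mul0r.
  by rewrite mulrDl !linearD /= ih mulrDl !(tpureM, tens_mapE) /= !mulr1.
- by move=> i a l; rewrite /= /inA !tpureM !mul1r !mulr1 tens_mapE.
move=> b q.
(* With L_g : x t |-> x g t, [insert_untwist_cotensor] reads b e_j = sum_m L_(nu e_m)(e_j a_m). Its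
   coefficient at e_q is the sum over i and m of [c m i] times the coefficient of e_i in e_j a_m;
   this dictates the witness, which is the same for all j. *)
pose a m := slice (lam m) (iB b).
have bE : iB b = \sum_m a m *t e m := tens_slice_sum e_span _.
pose c m i := lam q (nu (e m) * e i) : k.
exists (fun i => \sum_m c m i *: a m) => j.
have /choice[d dP] := fun m => spanB (a m *t e j).
exists (fun i l => \sum_m c m i *: d m l); split.
  move=> i; transitivity ((\sum_m c m i *: a m) *t e j).
    by rewrite /= /inA tpureM mul1r mulr1.
  rewrite linear_sumlz.
  under [RHS]eq_bigr do rewrite raddf_sum mulr_suml.
  rewrite exchange_big; apply: eq_bigr => m _.
  rewrite linearZl_LR /= dP scaler_sumr; apply: eq_bigr => l _.
  by rewrite -scalerAl.
(* L g sends x t to x g t for x in B and t in T. *)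
have [L [LE LB]] : exists L : T -> {linear A ⊗ T -> A ⊗ T},
    (forall g x, L g x = tens_map idfun (insert g) (untwist kap rhoA x)) /\
    forall g (b' : B) l, L g (iB b' * (1 *t e l)) =
      \sum_p iB ((lam p (g * e l) : k) *: b') * (1 *t e p).
  exists (fun g => tens_map idfun (insert g) \o untwist kap rhoA); split=> // g b' l /=.
  rewrite (untwist_cotensor canK); last exact: (valP b').
  rewrite insert_assoc {1}(e_span (g * e l)) linear_sumr mulr_sumr.
  by apply: eq_bigr => p _; rewrite linearZr_LR -scalerAr scalerAl.
have := insert_untwist_cotensor (rhoA := rhoA) canK kapK (a := a) (t := e) (e j) nuP.
rewrite -bE => /(_ (valP b)).
under eq_bigr => m _.
  rewrite -LE dP linear_sum; under eq_bigr => l _ do rewrite LB.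
  rewrite exchange_big; over.
rewrite exchange_big /=; under eq_bigr => p _.
  under eq_bigr do rewrite -mulr_suml. rewrite -mulr_suml. over.
move=> eqB.
(* Coefficients of e_p are compared in [eqB]; the case p = q is the claim. *)
have := injB (fun p => \sum_m \sum_l (lam p (nu (e m) * e l) : k) *: d m l)
  (fun p => if j == p then b else 0).
rewrite (bigD1 j (F := fun p => iB (if _ then _ else _) * _)) //= eqxx [X in _ = _ + X]big1; last first.
  by move=> p pj; rewrite eq_sym (negbTE pj) mul0r.
rewrite addr0 => <-; first by rewrite exchange_big.
rewrite -eqB; apply: eq_bigr => p _; congr (_ * _).
rewrite -[LHS]/(iB _) rmorph_sum; apply: eq_bigr => m _.
by rewrite rmorph_sum.
Qed.
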